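(* Let $k\in\mathcal{S}_{-1}$ be the Sonine kernel associate to the kernel $\kappa\in\mathcal{S}_{-1}$, i.e. $\kappa,k\in C_{-1,0}(0,+\infty)$ and $(\kappa*k)(t)=1$ for all $t>0$, and let $n\in\mathbb{N}$. For a function $f\in C_{-1}^n(0,+\infty)$, its $n$-fold general fractional derivative in the Caputo sense, $$({}_*\mathbb{D}^n_{(k)}f)(t)=(\mathbb{D}^n_{(k)}f)(t)-\sum_{j=0}^{n-1}f^{(j)}(0)\,\frac{d^{n-j-1}}{dt^{n-j-1}}k^n(t),\quad t>0,$$ exists in the usual sense and coincides with the $n$-fold algebraic general fractional derivative of Caputo type of $f$, that is, in the field $\mathcal{F}_{-1}$ of convolution quotients (where functions in $C_{-1}(0,+\infty)$ are identified with their images under the embedding of $C_{-1}(0,+\infty)$ into $\mathcal{F}_{-1}$), $$({}_*\mathbb{D}_{(k)}^n f)(t)={}_*\mathbb{D}_{(k)}^n f=S_\kappa^n\cdot f-S_\kappa^n\cdot f_n,\qquad f_n(t)=\sum_{j=0}^{n-1}f^{(j)}(0)\,h_{j+1}(t),\quad t>0.$$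
   Context: Functions are real- or complex-valued. $C_{-1}(0,+\infty)$ is the space of functions $f$ on $(0,+\infty)$ of the form $f(t)=t^{p-1}f_1(t)$, $t>0$, for some $p>0$ and some $f_1\in C[0,+\infty)$. $C_{-1,0}(0,+\infty)$ is the set of functions of the form $f(t)=t^{p-1}f_1(t)$, $t>0$, with some $0<p<1$ and $f_1\in C[0,+\infty)$. For $m\in\mathbb{N}_0$, $f\in C_{-1}^m(0,+\infty)$ means $f^{(m)}\in C_{-1}(0,+\infty)$. For $m\ge 1$ a function $f\in C_{-1}^m(0,+\infty)$ has finite limits $f^{(j)}(0):=\lim_{t\to0+}f^{(j)}(t)$, $0\le j\le m-1$, and is identified with its continuous extension to $[0,+\infty)$, which lies in $C^{m-1}[0,+\infty)$. For $\beta>0$, $h_\beta(t)=\frac{t^{\beta-1}}{\Gamma(\beta)}$, $t>0$. $(f*g)(t)=\int_0^t f(\tau)g(t-\tau)\,d\tau$ is the Laplace convolution, and $\kappa^n=\kappa*\cdots*\kappa$, $k^n=k*\cdots*k$ ($n$ factors). With $+$ and $*$, $C_{-1}(0,+\infty)$ is a commutative ring $\mathcal{R}_{-1}$ without divisors of zero (and without unity). $\mathcal{S}_{-1}$ is the set of Sonine kernels occurring in pairs $\kappa,k\in C_{-1,0}(0,+\infty)$ with $(\kappa*k)(t)=1$ for $t>0$; $k$ and $\kappa$ are then called associate to each other. The $n$-fold general fractional derivative in the Riemann-Liouville sense is $(\mathbb{D}^n_{(k)}f)(t)=\frac{d^n}{dt^n}(k^n*f)(t)$, $t>0$; the $n$-fold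 general fractional derivative ${}_*\mathbb{D}^n_{(k)}$ in the Caputo sense is defined from it by the formula displayed in the claim. $\mathcal{F}_{-1}$ is the field of convolution quotients of $\mathcal{R}_{-1}$: its elements are classes $\frac{f}{g}$ of pairs $(f,g)$, $f,g\in C_{-1}(0,+\infty)$, $g\not\equiv0$, under $(f_1,g_1)\sim(f_2,g_2)\Leftrightarrow f_1*g_2=f_2*g_1$, with $\frac{f_1}{g_1}+\frac{f_2}{g_2}=\frac{f_1*g_2+f_2*g_1}{g_1*g_2}$ and $\frac{f_1}{g_1}\cdot\frac{f_2}{g_2}=\frac{f_1*f_2}{g_1*g_2}$. The ring $\mathcal{R}_{-1}$ is embedded in $\mathcal{F}_{-1}$ by $f\mapsto\frac{f*\kappa}{\kappa}$. The element $S_\kappa:=\frac{\kappa}{\kappa^2}\in\mathcal{F}_{-1}$ is the multiplicative inverse of $\kappa$ in $\mathcal{F}_{-1}$, and $S_\kappa^n$ is its $n$-th power in $\mathcal{F}_{-1}$. For $f\in C^{n-1}[0,+\infty)$ the $n$-fold algebraic general fractional derivative of Caputo type is defined as the element $S_\kappa^n\cdot f-S_\kappa^n\cdot f_n$ of $\mathcal{F}_{-1}$, with $f_n(t)=\sum_{j=0}^{n-1}f^{(j)}(0)h_{j+1}(t)$, where $f$ and $f_n$ are interpreted as elements of $\mathcal{F}_{-1}$; it is denoted by the same symbol ${}_*\mathbb{D}^n_{(k)}f$.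
   Formalization: For n≥2 the displayed Caputo formula can fail to exist (k^n need not be differentiable); it is proved when the derivatives of k^n with f^(j)(0)≠0 exist, and in general with d^n/dt^n applied to k^n*f − Σ f^(j)(0) h_{j+1}*k^n as a whole. *)

(* Defs.v *)
From Stdlib Require Import Reals.
From Coquelicot Require Import Coquelicot.

Set Implicit Arguments.
Open Scope R_scope.

(* Functions are real- or complex-valued: everything below is parametrised by
   the choice of scalars.  A function on (0,+oo) is a function on R of which only
   the values at t > 0 are ever used. *)
Inductive scalars : Set := Reals | Complexes.

Definition Sc (s : scalars) : CompleteNormedModule R_AbsRing :=
  match s with
  | Reals => R_CompleteNormedModule
  | Complexes => C_R_CompleteNormedModule
  end.

Definition smul (s : scalars) : Sc s -> Sc s -> Sc s :=
  match s return Sc s -> Sc s -> Sc s with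
  | Reals => Rmult
  | Complexes => Cmult
  end.

Definition sone (s : scalars) : Sc s :=
  match s return Sc s with
  | Reals => 1
  | Complexes => RtoC 1
  end.

Section Functions.

Context {s : scalars}.
Notation K := (Sc s).

Definition power_times_continuous (p : R) (f : R -> K) : Prop :=
  exists f1 : R -> K,
    continuous_on (fun x => 0 <= x) f1 /\
    forall t, 0 < t -> f t = scal (Rpower t (p - 1)) (f1 t).

(* C_{-1}(0,+oo) *)
Definition C_m1 (f : R -> K) : Prop :=
  exists p, 0 < p /\ power_times_continuous p f.

(* C_{-1,0}(0,+oo) *)
Definition C_m1_0 (f : R -> K) : Prop :=
  exists p, 0 < p < 1 /\ power_times_continuous p f.

(* Total derivatives and total right limit at 0; [iota] picks the unique value
   with the given property, and is unspecified when there is none. *)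
Definition deriv (f : R -> K) : R -> K :=
  fun t => iota (fun l : K => is_derive f t l).

Definition deriv_n (n : nat) (f : R -> K) : R -> K := Nat.iter n deriv f.

Definition differentiable_n (n : nat) (f : R -> K) : Prop :=
  forall j, (j < n)%nat -> forall t, 0 < t -> ex_derive (deriv_n j f) t.

Definition value0 (f : R -> K) : K :=
  iota (fun l : K => filterlim f (at_right 0) (locally l)).

(* C_{-1}^m(0,+oo) *)
Definition C_m1_n (m : nat) (f : R -> K) : Prop :=
  differentiable_n m f /\ C_m1 (deriv_n m f).

(* Laplace convolution; the integral is improper at both end points, where the
   elements of C_{-1}(0,+oo) may be unbounded. *)
Definition conv (f g : R -> K) : R -> K :=
  fun t => RInt_gen (fun tau => smul s (f tau) (g (t - tau)))
                    (at_right 0) (at_left t).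

(* f^n = f * ... * f with n factors, for n >= 1 only: the ring has no unity. *)
Definition conv_pow (f : R -> K) (n : nat) : R -> K :=
  Nat.iter (pred n) (conv f) f.

Definition Sonine_pair (kappa k : R -> K) : Prop :=
  C_m1_0 kappa /\ C_m1_0 k /\ forall t, 0 < t -> conv kappa k t = sone s.

Definition Gamma (b : R) : R :=
  RInt_gen (fun t => Rpower t (b - 1) * exp (- t))
           (at_right 0) (Rbar_locally p_infty).

Definition h (b : R) : R -> K :=
  fun t => scal (Rpower t (b - 1) / Gamma b) (sone s).

(* f^{(j)}(0) *)
Definition deriv0 (j : nat) (f : R -> K) : K := value0 (deriv_n j f).

(* sum_{j=0}^{n-1} F j, for n >= 1 *)
Definition sum_upto (n : nat) (F : nat -> K) : K := sum_n F (pred n).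

Definition taylor (n : nat) (f : R -> K) : R -> K :=
  fun t => sum_upto n (fun j => smul s (deriv0 j f) (h (INR (S j)) t)).

Definition RL_derivative (k : R -> K) (n : nat) (f : R -> K) : R -> K :=
  deriv_n n (conv (conv_pow k n) f).

Definition Caputo_derivative (k : R -> K) (n : nat) (f : R -> K) : R -> K :=
  fun t =>
    minus (RL_derivative k n f t)
          (sum_upto n (fun j =>
             smul s (deriv0 j f) (deriv_n (n - j - 1) (conv_pow k n) t))).

(* The derivatives of k^n that enter the Caputo formula with a nonzero
   coefficient exist on (0,+oo).  This is void for n = 1, but for n >= 2 it is not
   automatic: for k(t) = h_{1/2}(t) + h_{11/10}(t - 1) 1_{t > 1}, which has an
   associate kernel in C_{-1,0}(0,+oo), k^2 = 1 + 2 h_{8/5}(t - 1) on (1,2) and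
   k^2 = 1 on (0,1), so k^2 is not differentiable at t = 1; for n = 2 and f = 1
   both terms of the Caputo formula, (k^2 * f)'' and f(0) (k^2)', fail to exist
   there. *)
Definition Caputo_terms_exist (k : R -> K) (n : nat) (f : R -> K) : Prop :=
  forall j, (j < n)%nat -> deriv0 j f <> zero ->
    differentiable_n (n - j - 1) (conv_pow k n).

(* The Caputo formula with d^n/dt^n taken jointly, using
   d^{n-j-1}/dt^{n-j-1} k^n = d^n/dt^n (h_{j+1} * k^n):
   the difference can be differentiable when its terms are not. *)
Definition Caputo_primitive (k : R -> K) (n : nat) (f : R -> K) : R -> K :=
  fun t =>
    minus (conv (conv_pow k n) f t)
          (sum_upto n (fun j =>
             smul s (deriv0 j f) (conv (h (INR (S j))) (conv_pow k n) t))).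

Definition Caputo_derivative_joint (k : R -> K) (n : nat) (f : R -> K) : R -> K :=
  deriv_n n (Caputo_primitive k n f).

End Functions.

(* Convolution quotients.  The operations are given by formulas on fractions;
   the elements of F_{-1} are the classes of the proper fractions. *)
Record fraction (s : scalars) := Fraction { num : R -> Sc s; den : R -> Sc s }.

Arguments Fraction {s} num den.
Arguments num {s} f _.
Arguments den {s} f _.

Section Quotients.

Context {s : scalars}.
Notation K := (Sc s).

Definition proper_fraction (p : fraction s) : Prop :=
  C_m1 (num p) /\ C_m1 (den p) /\ ~ (forall t, 0 < t -> den p t = zero).

Definition equiv_fraction (p q : fraction s) : Prop :=
  forall t, 0 < t -> conv (num p) (den q) t = conv (num q) (den p) t.

Definition class_of (p : fraction s) : fraction s -> Prop :=
  fun q => proper_fraction q /\ equiv_fraction p q.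

Definition eq_quotient (p q : fraction s) : Prop :=
  proper_fraction p /\ proper_fraction q /\ class_of p = class_of q.

Definition qadd (p q : fraction s) : fraction s :=
  Fraction (fun t => plus (conv (num p) (den q) t) (conv (num q) (den p) t))
           (conv (den p) (den q)).

Definition qopp (p : fraction s) : fraction s :=
  Fraction (fun t => opp (num p t)) (den p).

Definition qsub (p q : fraction s) : fraction s := qadd p (qopp q).

Definition qmul (p q : fraction s) : fraction s :=
  Fraction (conv (num p) (num q)) (conv (den p) (den q)).

(* p^n for n >= 1 *)
Definition qpow (p : fraction s) (n : nat) : fraction s :=
  Nat.iter (pred n) (qmul p) p.

Definition embed (kappa f : R -> K) : fraction s :=
  Fraction (conv f kappa) kappa.

Definition S_elt (kappa : R -> K) : fraction s :=
  Fraction kappa (conv_pow kappa 2).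

Definition algebraic_Caputo (kappa : R -> K) (n : nat) (f : R -> K) : fraction s :=
  qsub (qmul (qpow (S_elt kappa) n) (embed kappa f))
       (qmul (qpow (S_elt kappa) n) (embed kappa (taylor n f))).

(* g is a function in C_{-1}(0,+oo) and, as an element of F_{-1}, it is the
   algebraic general fractional derivative of f. *)
Definition coincides_with_algebraic
    (kappa : R -> K) (n : nat) (f g : R -> K) : Prop :=
  C_m1 g /\ eq_quotient (embed kappa g) (algebraic_Caputo kappa n f).

End Quotients.

(* Main.v *)
(* A function is in C_{-1} iff it is continuous on (0,+oo) and O(t^(p-1)) at 0 for some
   p in (0,1].  Convolution is bounded for the weighted sup norms attached to these
   conditions, and every element of C_{-1} is a limit, in a slightly weaker such norm, of
   continuous functions vanishing on (-oo,0].  For the latter the convolution is a proper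
   integral, whose continuity and associativity come from the continuous Fubini theorem;
   both pass to the limit.

   Convolution with 1 is integration, so that h_{j+1} = 1 * ... * 1 and
   f = f_n + h_n * f^(n).  Hence k^n * f - sum_j f^(j)(0) h_{j+1} * k^n is
   h_n * (k^n * f^(n)), whose n-th derivative is g = k^n * f^(n), a function in C_{-1}.
   On the algebraic side, kappa * k = 1 gives kappa^n * k^n = h_n, so that
   S_kappa^n (f - f_n) = S_kappa^n h_n f^(n) = k^n f^(n) = g. *)

From Stdlib Require Import Reals Factorial Lra Lia ssreflect Setoid Morphisms.
From Stdlib Require Import FunctionalExtensionality PropExtensionality.
From Coquelicot Require Import Coquelicot.
Require Import Defs.
Set Implicit Arguments.
Open Scope R_scope.
Open Scope general_if_scope.

(** * Scalars *)

(** The integral in [conv] is improper at both ends, where either factor may blow up, so Fubini on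
    the triangle does not apply directly. Cutting f off near 0 makes no small error in the norm sup
    t^(1-p) |f t|, but it does once p is replaced by p/2, whence the weaker norm. With p <= 1 the
    weight t^(p-1) is non-increasing, so each factor of a convolution can be bounded on the half of
    (0,t) away from its singularity.

    The second obstacle is that neither (k^n * f)^(n) nor the derivatives of k^n need exist. The
    joint derivative is therefore treated first; when the derivatives of k^n with nonzero
    coefficients exist, the sum is differentiated term by term and added back, which proves the
    existence of the Riemann-Liouville term.

    In the algebra, equality of classes rests on transitivity of cross multiplication, hence on
    cancelling denominators. The denominators of the two quotients compared are convolution products
    of copies of kappa, and those can be cancelled by means of k. *)

Section Scalars.

Context {s : scalars}.
Notation K := (Sc s).

Lemma smul_comm (a b : K) : smul s a b = smul s b a.
Proof. destruct s; [apply Rmult_comm | apply Cmult_comm]. Qed.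

Lemma smul_assoc (a b c : K) : smul s (smul s a b) c = smul s a (smul s b c).
Proof.
  destruct s; simpl in *; [apply Rmult_assoc | symmetry; apply Cmult_assoc].
Qed.

Lemma smul_one_l (a : K) : smul s (sone s) a = a.
Proof. destruct s; [apply Rmult_1_l | apply Cmult_1_l]. Qed.

Lemma smul_plus_l (a b c : K) :
  smul s (plus a b) c = plus (smul s a c) (smul s b c).
Proof.
  destruct s; simpl in *; [apply Rmult_plus_distr_r | apply Cmult_plus_distr_r].
Qed.

Lemma smul_scal_l (r : R) (a b : K) : smul s (scal r a) b = scal r (smul s a b).
Proof.
  destruct s; simpl in *.
  - apply Rmult_assoc.
  - apply injective_projections; destruct a, b;
      unfold scal; simpl; unfold prod_scal, scal; simpl; unfold mult; simpl; ring.
Qed.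

Lemma norm_smul_le (a b : K) : norm (smul s a b) <= norm a * norm b.
Proof.
  destruct s; simpl in *.
  - right; apply Rabs_mult.
  - assert (E : forall z : C, @norm _ C_R_NormedModule z = Cmod z).
    { intros [x y]; unfold norm; simpl; unfold prod_norm, norm, Cmod; simpl.
      unfold abs; simpl; f_equal; rewrite !Rmult_1_r -!Rabs_mult.
      f_equal; apply Rabs_pos_eq, Rle_0_sqr. }
    right; etransitivity; [apply E|].
    etransitivity; [apply Cmod_mult|].
    now rewrite -!E.
Qed.

Lemma is_linear_smul (c : K) : is_linear (smul s c).
Proof.
  split.
  - intros x y; rewrite !(smul_comm c) ; apply smul_plus_l.
  - intros r x; rewrite !(smul_comm c) ; apply smul_scal_l.
  (* The bound in [is_linear] has to be positive, and c may be zero. *)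
  - exists (norm c + 1); split.
    + pose proof (norm_ge_0 c); lra.
    + intros x; eapply Rle_trans; [apply norm_smul_le|].
      pose proof (norm_ge_0 x); nra.
Qed.

Lemma continuous_smul {U : UniformSpace} (f g : U -> K) x :
  continuous f x -> continuous g x ->
  continuous (fun t => smul s (f t) (g t)) x.
Proof.
  destruct s; simpl in *; intros Hf Hg.
  - exact (continuous_mult f g x Hf Hg).
  - assert (F1 : forall u : U -> C,
      @continuous U (prod_UniformSpace R_UniformSpace R_UniformSpace) u x ->
      continuous (fun t => fst (u t)) x).
    { intros u Hu; apply (continuous_comp u fst); [exact Hu | apply continuous_fst]. }
    assert (F2 : forall u : U -> C,
      @continuous U (prod_UniformSpace R_UniformSpace R_UniformSpace) u x ->
      continuous (fun t => snd (u t)) x).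
    { intros u Hu; apply (continuous_comp u snd); [exact Hu | apply continuous_snd]. }
    apply (continuous_comp_2
      (fun t => fst (f t) * fst (g t) - snd (f t) * snd (g t))
      (fun t => fst (f t) * snd (g t) + snd (f t) * fst (g t))
      (fun a b => (a, b)) x).
    + apply (continuous_minus (V := R_NormedModule));
        apply (continuous_mult (K := R_AbsRing)); auto.
    + apply (continuous_plus (V := R_NormedModule));
        apply (continuous_mult (K := R_AbsRing)); auto.
    + apply continuous_ext with (fun z => z); [now intros []|].
      apply continuous_id.
Qed.

Lemma smul_zero_l (a : K) : smul s zero a = zero.
Proof. rewrite smul_comm; apply (linear_zero _ (is_linear_smul a)). Qed.

Lemma sone_neq_zero : sone s <> zero.
Proof.
  destruct s; simpl; intros E.
  - exact (R1_neq_R0 E).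
  - exact (R1_neq_R0 (f_equal fst E)).
Qed.

End Scalars.

(** Riemann sums commute with L, and L is continuous. It serves to move complex factors, which are
    not scalars of the real module, through an integral. *)
Lemma is_RInt_linear {V W : NormedModule R_AbsRing} (L : V -> W) (f : R -> V) a b l :
  is_linear L -> is_RInt f a b l -> is_RInt (fun t => L (f t)) a b (L l).
Proof.
  intros HL Hf.
  assert (HS : forall S, Riemann_sum (fun t => L (f t)) S = L (Riemann_sum f S)).
  { apply SF_cons_ind.
    - intros x; symmetry; apply (linear_zero _ HL).
    - intros h0 S IH; rewrite !Riemann_sum_cons IH.
      now rewrite (linear_plus _ HL) (linear_scal _ HL). }
  unfold is_RInt.
  apply filterlim_ext with
    (fun S => L (scal (sign (b - a)) (Riemann_sum f S))).
  - intros S; now rewrite (linear_scal _ HL) HS.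
  - eapply filterlim_comp; [exact Hf|]; exact: linear_cont.
Qed.

Lemma is_RInt_gen_linear {V W : NormedModule R_AbsRing} {Fa Fb : (R -> Prop) -> Prop}
  {FFa : Filter Fa} {FFb : Filter Fb} (L : V -> W) (f : R -> V) l :
  is_linear L -> is_RInt_gen f Fa Fb l -> is_RInt_gen (fun t => L (f t)) Fa Fb (L l).
Proof.
  intros HL Hf P HP.
  specialize (Hf _ (linear_cont L l HL _ HP)).
  unfold filtermapi in *; revert Hf; apply filter_imp; move=> [a b] [y [Hy HPy]].
  exists (L y); split; [exact: is_RInt_linear | exact: HPy].
Qed.

(** * Improper integrals *)

Lemma at_right_lt (a b : R) : a < b -> at_right a (fun x => a < x < b).
Proof.
  intros H; exists (mkposreal (b - a) ltac:(lra)); intros y Hy Hay; simpl in *.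
  move: Hy; rewrite /ball /= /AbsRing_ball /= /abs /minus /plus /opp /=.
  move/Rabs_def2; lra.
Qed.

Lemma at_left_gt (a b : R) : a < b -> at_left b (fun x => a < x < b).
Proof.
  intros H; exists (mkposreal (b - a) ltac:(lra)); intros y Hy Hay; simpl in *.
  move: Hy; rewrite /ball /= /AbsRing_ball /= /abs /minus /plus /opp /=.
  move/Rabs_def2; lra.
Qed.

Lemma filter_prod_interior (a b : R) : a < b ->
  filter_prod (at_right a) (at_left b)
    (fun xy => a < fst xy /\ fst xy < snd xy /\ snd xy < b).
Proof.
  intros H; set m := (a + b) / 2.
  apply (Filter_prod _ _ _ (fun x => a < x < m) (fun y => m < y < b)).
  - apply at_right_lt; unfold m; lra.
  - apply at_left_gt; unfold m; lra.
  - intros x y; simpl; lra.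
Qed.

Lemma is_RInt_gen_filterlim {V : NormedModule R_AbsRing} {Fa Fb : (R -> Prop) -> Prop}
  {FFa : Filter Fa} {FFb : Filter Fb} (f : R -> V) (g : R * R -> V) l :
  filter_prod Fa Fb (fun xy => is_RInt f (fst xy) (snd xy) (g xy)) ->
  filterlim g (filter_prod Fa Fb) (locally l) ->
  is_RInt_gen f Fa Fb l.
Proof.
  intros Hf Hg P HP; specialize (Hg P HP).
  unfold filtermapi, filtermap in *.
  generalize (filter_and _ _ Hf Hg); apply filter_imp.
  move=> xy [H1 H2]; now exists (g xy).
Qed.

(** One-sided limits replace the values of F at the end points, where f may be unbounded. *)
Lemma is_RInt_gen_antiderivative {V : CompleteNormedModule R_AbsRing} (f F : R -> V)
  (a b : R) (la lb : V) : a < b ->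
  (forall x, a < x < b -> is_derive F x (f x)) ->
  (forall x, a < x < b -> continuous f x) ->
  filterlim F (at_right a) (locally la) ->
  filterlim F (at_left b) (locally lb) ->
  is_RInt_gen f (at_right a) (at_left b) (minus lb la).
Proof.
  intros Hab HF Hf Ha Hb.
  apply is_RInt_gen_filterlim with (fun xy => minus (F (snd xy)) (F (fst xy))).
  - generalize (filter_prod_interior Hab); apply filter_imp.
    move=> [x y] /= H; apply is_RInt_derive; intros z; rewrite Rmin_left ?Rmax_right;
      try lra; intros; [apply HF | apply Hf]; lra.
  - apply (filterlim_comp_2 (G := locally lb) (H := locally (opp la))
      (fun xy => F (snd xy)) (fun xy => opp (F (fst xy))) plus).
    + eapply filterlim_comp; [apply filterlim_snd | exact Hb].
    + eapply filterlim_comp; [eapply filterlim_comp|apply: filterlim_opp].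
      apply filterlim_fst. exact Ha.
    + apply: filterlim_plus.
Qed.

(** The order of x and y is left free, as in the Cauchy criterion where the two end points are not
    comparable in advance. *)
Lemma norm_RInt_antiderivative {V : CompleteNormedModule R_AbsRing} (f : R -> V)
  (g G : R -> R) (a b x y : R) (l : V) :
  (forall z, a < z < b -> norm (f z) <= g z) ->
  (forall z, a < z < b -> is_derive G z (g z)) ->
  (forall z, a < z < b -> continuous g z) ->
  a < x < b -> a < y < b -> is_RInt f x y l -> norm l <= Rabs (G y - G x).
Proof.
  intros Hfg HG Hg.
  assert (main : forall x y l, a < x -> x <= y -> y < b -> is_RInt f x y l ->
    norm l <= Rabs (G y - G x)).
  { intros u v m Hu Huv Hv Hm.
    apply Rle_trans with (2 := Rle_abs _).
    apply (norm_RInt_le f g u v m (G v - G u)); auto.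
    - intros; apply Hfg; lra.
    - apply (is_RInt_derive G g u v); intros z; rewrite Rmin_left ?Rmax_right; try lra;
        intros; [apply HG | apply Hg]; lra. }
  intros Hx Hy Hl; destruct (Rle_lt_dec x y) as [H|H].
  - apply main; auto; lra.
  - rewrite -norm_opp Rabs_minus_sym; apply main; try lra; apply is_RInt_swap, Hl.
Qed.

(** Existence is the Cauchy criterion: near an end point, integrals of f are bounded by increments
    of G, which has a limit there. The bound on the norm is then the integral of g. *)
Lemma is_RInt_gen_dominated {V : CompleteNormedModule R_AbsRing} (f : R -> V)
  (g G : R -> R) (a b la lb : R) : a < b ->
  (forall z, a < z < b -> continuous f z) ->
  (forall z, a < z < b -> norm (f z) <= g z) ->
  (forall z, a < z < b -> is_derive G z (g z)) ->
  (forall z, a < z < b -> continuous g z) ->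
  filterlim G (at_right a) (locally la) ->
  filterlim G (at_left b) (locally lb) ->
  exists l, is_RInt_gen f (at_right a) (at_left b) l /\ norm l <= lb - la.
Proof.
  intros Hab Hf Hfg HG Hg Ha Hb.
  assert (ex : forall x y, a < x < b -> a < y < b -> ex_RInt f x y).
  { intros x y Hx Hy; apply (ex_RInt_continuous f); intros z Hz; apply Hf; split.
    - apply Rlt_le_trans with (2 := proj1 Hz); apply Rmin_glb_lt; lra.
    - apply Rle_lt_trans with (1 := proj2 Hz); apply Rmax_lub_lt; lra. }
  assert (Hl : exists l, is_RInt_gen f (at_right a) (at_left b) l).
  { refine (proj1 (filterlimi_locally_cauchy (U := V)
      (F := filter_prod (at_right a) (at_left b))
      (fun xy => is_RInt f (fst xy) (snd xy)) _) _).
    { generalize (filter_prod_interior Hab); apply filter_imp.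
      move=> [x y] /= H; split.
      - apply ex; lra.
      - intros l1 l2 H1 H2; rewrite -(is_RInt_unique _ _ _ _ H1).
        apply (is_RInt_unique _ _ _ _ H2). }
    intros eps.
    (* Each of the two end pieces contributes less than 2 eps / 5, so the total 4 eps / 5 stays
       strictly below eps. *)
    assert (He : 0 < eps / 5) by (destruct eps; simpl; lra).
    set e := mkposreal _ He.
    exists (fun xy => (a < fst xy < b /\ ball la e (G (fst xy))) /\
                      (a < snd xy < b /\ ball lb e (G (snd xy)))); split.
    { apply (Filter_prod _ _ _ (fun x => a < x < b /\ ball la e (G x))
                               (fun y => a < y < b /\ ball lb e (G y))).
      - apply filter_and; [now apply at_right_lt | apply Ha, locally_ball].
      - apply filter_and; [now apply at_left_gt | apply Hb, locally_ball].
      - now intros x y. }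
    move=> [x y] [x' y'] /= [[Hx Bx] [Hy By]] [[Hx' Bx'] [Hy' By']] l l' Hl Hl'.
    destruct (ex x x' Hx Hx') as [m1 M1], (ex y' y Hy' Hy) as [m2 M2].
    (* The integral over [x,y] is split at x' and y'; only the pieces from x to x' and from y' to y
       survive in l - l'. *)
    assert (E : l = plus (plus m1 l') m2).
    { rewrite -(is_RInt_unique _ _ _ _ Hl); apply is_RInt_unique.
      apply (is_RInt_Chasles f x y' y); auto.
      apply (is_RInt_Chasles f x x' y'); auto. }
    apply ball_sym, (norm_compat1 (V := V)).
    assert (E' : plus m1 m2 = minus l l').
    { rewrite E /minus -!plus_assoc; f_equal; rewrite plus_comm -plus_assoc.
         now rewrite plus_opp_l plus_zero_r. }
    apply Rle_lt_trans with (norm m1 + norm m2).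
    { refine (Rle_trans _ _ _ _ (norm_triangle m1 m2)).
      right; symmetry; exact (f_equal norm E'). }
    pose proof (norm_RInt_antiderivative Hfg HG Hg Hx Hx' M1) as N1.
    pose proof (norm_RInt_antiderivative Hfg HG Hg Hy' Hy M2) as N2.
    move: Bx By Bx' By' N1 N2.
    rewrite /ball /= /AbsRing_ball /= /abs /minus /plus /opp /= /e /=.
    move=> /Rabs_def2 Bx /Rabs_def2 By /Rabs_def2 Bx' /Rabs_def2 By' N1 N2.
    assert (Rabs (G x' - G x) < 2 * (eps / 5)) by (apply Rabs_def1; lra).
    assert (Rabs (G y - G y') < 2 * (eps / 5)) by (apply Rabs_def1; lra).
    apply Rle_lt_trans with (1 := Rplus_le_compat _ _ _ _ N1 N2); lra. }
  destruct Hl as [l Hl]; exists l; split; auto.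
  apply (RInt_gen_norm (Fa := at_right a) (Fb := at_left b) f g l (lb - la)); auto.
  - generalize (filter_prod_interior Hab); apply filter_imp; move=> xy; lra.
  - generalize (filter_prod_interior Hab); apply filter_imp; move=> xy H z Hz.
    apply Hfg; lra.
  - now apply is_RInt_gen_antiderivative with (F := G).
Qed.

(** The proper integral is continuous in its end points. This turns convolutions of continuous
    functions into proper integrals. *)
Lemma is_RInt_gen_continuous {V : CompleteNormedModule R_AbsRing} (f : R -> V) (a b : R) :
  a < b -> (forall x, continuous f x) ->
  is_RInt_gen f (at_right a) (at_left b) (RInt f a b).
Proof.
  intros Hab Hf.
  assert (ex : forall x y, is_RInt f x y (RInt f x y)).
  { intros; apply (RInt_correct f), (ex_RInt_continuous f); auto. }
  apply is_RInt_gen_filterlim with (fun xy => RInt f (fst xy) (snd xy)).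
  - generalize (filter_prod_interior Hab); apply filter_imp; auto.
  - assert (C : continuous (fun z : R * R => RInt f (fst z) (snd z)) (a, b)).
    { apply (continuous_RInt f a b (fun x y => RInt f x y)).
      apply filter_forall; auto. }
    assert (L : forall x, filter_le (at_right x) (locally x)) by
      (intros x P HP; unfold at_right, within; revert HP; apply filter_imp; auto).
    assert (L' : forall x, filter_le (at_left x) (locally x)) by
      (intros x P HP; unfold at_left, within; revert HP; apply filter_imp; auto).
    intros P HP; specialize (C P HP).
    destruct C as [e He].
    apply (Filter_prod _ _ _ (ball a e) (ball b e)).
    + apply L, locally_ball.
    + apply L', locally_ball.
    + intros x y Hx Hy; apply He; now split.
Qed.

Lemma filterlim_reflect_right (t : R) :
  filterlim (fun x => t - x) (at_right 0) (at_left t).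
Proof.
  intros P [e He]; exists e; intros y Hy Hy0; apply He; [|lra].
  move: Hy; rewrite /ball /= /AbsRing_ball /= /abs /minus /plus /opp /=.
  by replace (t - y + - t) with (- (y + - 0)) by ring; rewrite Rabs_Ropp.
Qed.

Lemma filterlim_reflect_left (t : R) :
  filterlim (fun x => t - x) (at_left t) (at_right 0).
Proof.
  intros P [e He]; exists e; intros y Hy Hy0; apply He; [|lra].
  move: Hy; rewrite /ball /= /AbsRing_ball /= /abs /minus /plus /opp /=.
  by replace (t - y + - 0) with (- (y + - t)) by ring; rewrite Rabs_Ropp.
Qed.

Lemma is_RInt_gen_reflect {V : NormedModule R_AbsRing} (f : R -> V) (t : R) (l : V) :
  is_RInt_gen f (at_right 0) (at_left t) l ->
  is_RInt_gen (fun x => f (t - x)) (at_right 0) (at_left t) l.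
Proof.
  intros Hf P HP.
  destruct (Hf P HP) as [Q Q' HQ HQ' H].
  apply (Filter_prod _ _ _ (fun x => Q' (t - x)) (fun y => Q (t - y))).
  - apply filterlim_reflect_right, HQ'.
  - apply (@filterlim_reflect_left t _), HQ.
  - intros x y Hx Hy; destruct (H _ _ Hy Hx) as [I [HI PI]]; exists I; split; auto.
    simpl in *.
    (* The substitution gives one sign through its derivative -1 and one through the exchange of the
       end points. *)
    apply is_RInt_ext with (fun z => opp (opp (f (t - z)))).
    { intros z _; exact (opp_opp (f (t - z))). }
    rewrite -(opp_opp I); apply is_RInt_opp.
    apply is_RInt_swap in HI.
    apply is_RInt_ext with (fun z => scal (-1) (f (-1 * z + t))).
    { intros z _; rewrite (scal_opp_one (K := R_AbsRing)). apply (f_equal (fun w => opp (f w))); ring. }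
    apply (is_RInt_comp_lin f (-1) t x y).
    now replace (-1 * x + t) with (t - x) by ring; replace (-1 * y + t) with (t - y) by ring.
Qed.

(** * Real powers and elementary limits *)

Lemma Rpower_gt_0 x y : 0 < Rpower x y.
Proof. apply exp_pos. Qed.

Lemma Rpower_le_antitone (a b e : R) : e <= 0 -> 0 < a <= b -> Rpower b e <= Rpower a e.
Proof.
  intros He Hab.
  replace e with (- - e) by ring; rewrite (Rpower_Ropp b) (Rpower_Ropp a).
  apply Rinv_le_contravar; [apply Rpower_gt_0|].
  apply Rle_Rpower_l; lra.
Qed.

Lemma is_derive_Rpower (p x : R) : 0 < x ->
  is_derive (fun t => Rpower t p) x (p * Rpower x (p - 1)).
Proof. intros H; apply is_derive_Reals; now apply derivable_pt_lim_power. Qed.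

Lemma continuous_Rpower (p x : R) : 0 < x -> continuous (fun t => Rpower t p) x.
Proof.
  intros H; apply: ex_derive_continuous; eexists; now apply is_derive_Rpower.
Qed.

Lemma Rpower_lt_radius (p eps x : R) : 0 < p -> 0 < eps ->
  0 < x < Rpower eps (/ p) -> Rpower x p < eps.
Proof.
  intros Hp He Hx.
  apply Rlt_le_trans with (Rpower (Rpower eps (/ p)) p).
  - apply Rlt_Rpower_l; lra.
  - rewrite Rpower_mult Rinv_l ?Rpower_1; lra.
Qed.

Lemma filterlim_Rpower_0 (p : R) : 0 < p ->
  filterlim (fun t => Rpower t p) (at_right 0) (locally 0).
Proof.
  intros Hp; apply filterlim_locally; intros eps.
  exists (mkposreal _ (Rpower_gt_0 eps (/ p))); intros y Hy Hy0.
  move: Hy; rewrite /ball /= /AbsRing_ball /= /abs /minus /plus /opp /=.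
  move/Rabs_def2 => Hy.
  rewrite Ropp_0 Rplus_0_r Rabs_pos_eq; [|left; apply Rpower_gt_0].
  apply Rpower_lt_radius; [lra | apply cond_pos | lra].
Qed.

Lemma continuous_eps {V : NormedModule R_AbsRing} (f : R -> V) (x : R) :
  continuous f x <->
  forall eps, 0 < eps -> exists d, 0 < d /\
    forall y, Rabs (y - x) < d -> norm (minus (f y) (f x)) < eps.
Proof.
  split.
  - intros Hf eps He.
    destruct (Hf _ (locally_ball_norm (V := V) (f x) (mkposreal eps He))) as [d Hd].
    exists d; split; [apply cond_pos|]; intros y Hy; exact (Hd y Hy).
  - intros H; apply filterlim_locally_ball_norm; intros eps.
    destruct (H eps (cond_pos eps)) as [d [Hd H']].
    exists (mkposreal d Hd); intros y Hy; exact (H' y Hy).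
Qed.

Lemma filterlim_linear_combination {T : Type} {F : (T -> Prop) -> Prop} {FF : Filter F}
  (u v : T -> R) (a b x y : R) :
  filterlim u F (locally x) -> filterlim v F (locally y) ->
  filterlim (fun z => a * u z - b * v z) F (locally (a * x - b * y)).
Proof.
  intros Hu Hv.
  apply (filterlim_comp_2 (G := locally (a * x)) (H := locally (- (b * y)))
    (fun z => a * u z) (fun z => - (b * v z)) Rplus).
  - apply (filterlim_comp _ _ _ u (fun r => a * r) _ (locally x)); auto.
    apply: filterlim_scal_r.
  - apply (filterlim_comp _ _ _ (fun z => b * v z) Ropp _ (locally (b * y))).
    + apply (filterlim_comp _ _ _ v (fun r => b * r) _ (locally y)); auto.
      apply: filterlim_scal_r.
    + apply: (filterlim_opp (V := R_NormedModule)).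
  - apply: (filterlim_plus (V := R_NormedModule)).
Qed.

(** * Weighted bounds for the convolution *)

Section Conv.

Context {s : scalars}.
Notation K := (Sc s).

Lemma conv_unique (f g : R -> K) (t : R) (l : K) :
  is_RInt_gen (fun x => smul s (f x) (g (t - x))) (at_right 0) (at_left t) l ->
  conv f g t = l.
Proof. apply is_RInt_gen_unique. Qed.

(** No integrability is assumed: the two predicates handed to [iota] are equivalent, so the chosen
    values agree even if the integral diverges. *)
Lemma conv_ext (f f' g g' : R -> K) (t : R) : 0 < t ->
  (forall x, 0 < x < t -> f x = f' x) -> (forall x, 0 < x < t -> g x = g' x) ->
  conv f g t = conv f' g' t.
Proof.
  intros Ht Hf Hg; apply: eq_close; apply (close_iota (T := Sc s)); intros l.
  split; apply is_RInt_gen_ext; generalize (filter_prod_interior Ht);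
    apply filter_imp; move=> [a b] /= H x; rewrite Rmin_left ?Rmax_right; try lra;
    intros Hx; rewrite Hf ?Hg; auto; lra.
Qed.

Lemma conv_ext_pos (f f' g g' : R -> K) (t : R) :
  (forall x, 0 < x -> f x = f' x) -> (forall x, 0 < x -> g x = g' x) -> 0 < t ->
  conv f g t = conv f' g' t.
Proof. intros Hf Hg Ht; apply conv_ext; auto; intros x Hx; [apply Hf | apply Hg]; lra. Qed.

Definition weight_le (p T M : R) (f : R -> K) : Prop :=
  forall t, 0 < t <= T -> norm (f t) <= M * Rpower t (p - 1).

(* [regular] describes [C_m1] through pointwise bounds only; the restriction [p <= 1]
   costs nothing, as [t^(p-1)] only gets larger near 0 when [p] decreases. *)
Definition regular_at (p : R) (f : R -> K) : Prop :=
  (forall t, 0 < t -> continuous f t) /\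
  forall T, 0 < T -> exists M, 0 <= M /\ weight_le p T M f.

Definition regular (f : R -> K) : Prop := exists p, 0 < p <= 1 /\ regular_at p f.

(* The integrand is dominated by [(t/2)^(q-1) x^(p-1) + (t/2)^(p-1) (t-x)^(q-1)]: one of
   [x], [t - x] is at least [t/2]. *)
Lemma is_RInt_gen_conv_le (p q t M N : R) (f g : R -> K) :
  0 < p <= 1 -> 0 < q <= 1 -> 0 < t -> 0 <= M -> 0 <= N ->
  (forall x, 0 < x < t -> continuous f x) -> (forall x, 0 < x < t -> continuous g x) ->
  weight_le p t M f -> weight_le q t N g ->
  exists l, is_RInt_gen (fun x => smul s (f x) (g (t - x))) (at_right 0) (at_left t) l /\
    norm l <= M * N * (2 / p + 2 / q) * Rpower t (p + q - 1).
Proof.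
  intros Hp Hq Ht HM HN Hf Hg Wf Wg.
  set A := M * N * Rpower (t / 2) (q - 1); set B := M * N * Rpower (t / 2) (p - 1).
  assert (HMN : 0 <= M * N) by nra.
  assert (DG : forall z, 0 < z < t ->
    is_derive (fun z => A / p * Rpower z p - B / q * Rpower (t - z) q) z
      (A * Rpower z (p - 1) + B * Rpower (t - z) (q - 1))).
  { intros z Hz.
    replace (A * Rpower z (p - 1) + B * Rpower (t - z) (q - 1)) with
      (minus (scal (A / p) (p * Rpower z (p - 1)))
             (scal (B / q) (scal (-1) (q * Rpower (t - z) (q - 1))))).
    - apply: is_derive_minus; apply: is_derive_scal.
      + apply is_derive_Rpower; lra.
      + apply (is_derive_comp (fun x => Rpower x q) (fun z => t - z)).
        * apply is_derive_Rpower; lra.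
        * apply: is_derive_ext.
          { intros u; instantiate (1 := fun u => minus t u); reflexivity. }
          replace (-1) with (@minus R_AbelianGroup zero one)
            by (rewrite /minus /plus /opp /zero /one /=; ring).
          apply: is_derive_minus; [apply: is_derive_const | apply: is_derive_id].
    - rewrite /minus /plus /opp /scal /= /mult /=; field; lra. }
  destruct (is_RInt_gen_dominated (f := fun x => smul s (f x) (g (t - x)))
    (g := fun z => A * Rpower z (p - 1) + B * Rpower (t - z) (q - 1))
    (G := fun z => A / p * Rpower z p - B / q * Rpower (t - z) q)
    (la := A / p * 0 - B / q * Rpower t q) (lb := A / p * Rpower t p - B / q * 0) Ht)
    as [l [Hl Nl]].
  - intros z Hz; apply continuous_smul; [apply Hf; lra|].
    apply (continuous_comp (fun z => t - z) g); [|apply Hg; lra].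
    apply (continuous_minus (V := R_NormedModule));
      [apply continuous_const | apply continuous_id].
  - intros z Hz; apply Rle_trans with (1 := norm_smul_le _ _).
    apply Rle_trans with (M * Rpower z (p - 1) * (N * Rpower (t - z) (q - 1))).
    { apply Rmult_le_compat; try apply norm_ge_0; [apply Wf | apply Wg]; lra. }
    unfold A, B.
    pose proof (Rpower_gt_0 z (p - 1)) as P1; pose proof (Rpower_gt_0 (t - z) (q - 1)) as P2.
    pose proof (Rpower_gt_0 (t / 2) (p - 1)) as P3; pose proof (Rpower_gt_0 (t / 2) (q - 1)) as P4.
    destruct (Rle_lt_dec z (t / 2)) as [Hz2|Hz2].
    + assert (E : Rpower (t - z) (q - 1) <= Rpower (t / 2) (q - 1))
        by (apply Rpower_le_antitone; lra).
      apply (Rmult_le_compat_l (M * N * Rpower z (p - 1))) in E; [|nra].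
      assert (0 <= M * N * Rpower (t / 2) (p - 1) * Rpower (t - z) (q - 1))
        by (repeat apply Rmult_le_pos; lra).
      nra.
    + assert (E : Rpower z (p - 1) <= Rpower (t / 2) (p - 1))
        by (apply Rpower_le_antitone; lra).
      apply (Rmult_le_compat_l (M * N * Rpower (t - z) (q - 1))) in E; [|nra].
      assert (0 <= M * N * Rpower (t / 2) (q - 1) * Rpower z (p - 1))
        by (repeat apply Rmult_le_pos; lra).
      nra.
  - exact DG.
  - intros z Hz; apply (continuous_plus (V := R_NormedModule));
      apply (continuous_scal_r (V := R_NormedModule)).
    + apply continuous_Rpower; lra.
    + apply (continuous_comp (fun z => t - z) (fun z => Rpower z (q - 1)));
        [|apply continuous_Rpower; lra].
      apply (continuous_minus (V := R_NormedModule));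
        [apply continuous_const | apply continuous_id].
  - apply filterlim_linear_combination.
    + apply filterlim_Rpower_0; lra.
    + refine (filterlim_filter_le_1 (F := locally 0) _ _ _).
      { apply filter_le_within. }
      assert (C : continuous (fun z => Rpower (t - z) q) 0).
      { apply (continuous_comp (fun z => t - z) (fun z => Rpower z q));
          [|apply continuous_Rpower; lra].
        apply (continuous_minus (V := R_NormedModule));
          [apply continuous_const | apply continuous_id]. }
      rewrite /continuous Rminus_0_r in C; exact C.
  - apply filterlim_linear_combination.
    + refine (filterlim_filter_le_1 (F := locally t) _ _ _).
      { apply filter_le_within. }
      apply continuous_Rpower; lra.
    + eapply (filterlim_comp _ _ _ (fun z => t - z) (fun z => Rpower z q));
        [apply filterlim_reflect_left | apply filterlim_Rpower_0; lra].
  - exists l; split; auto; apply Rle_trans with (1 := Nl).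
    (* Source of the 2 in 2/p + 2/q: (t/2)^(a-1) is 2^(1-a) t^(a-1), and 2^(1-a) <= 2. *)
    assert (half : forall a b, 0 < a <= 1 ->
      Rpower (t / 2) (a - 1) * Rpower t b <= 2 * Rpower t (b + a - 1)).
    { intros a b Ha; unfold Rdiv; rewrite -Rpower_mult_distr; try lra.
      replace (b + a - 1) with ((a - 1) + b) by ring; rewrite (Rpower_plus (a - 1) b t).
      assert (Rpower (/ 2) (a - 1) <= 2).
      { apply Rle_trans with (exp (ln 2)); [|right; apply exp_ln; lra].
        rewrite /Rpower ln_Rinv; try lra.
        pose proof ln_lt_2; destruct (Req_dec a 0); [lra|].
        left; apply exp_increasing; nra. }
      pose proof (Rpower_gt_0 t (a - 1)); pose proof (Rpower_gt_0 t b).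
      apply Rle_trans with (Rpower (/ 2) (a - 1) * (Rpower t (a - 1) * Rpower t b));
        [right; ring|].
      apply Rmult_le_compat_r; [apply Rmult_le_pos; lra | lra]. }
    pose proof (half q p Hq) as h1; pose proof (half p q Hp) as h2.
    replace (q + p - 1) with (p + q - 1) in h2 by ring.
    assert (0 < / p) by (apply Rinv_0_lt_compat; lra).
    assert (0 < / q) by (apply Rinv_0_lt_compat; lra).
    apply (Rmult_le_compat_l (M * N * / p)) in h1; [|nra].
    apply (Rmult_le_compat_l (M * N * / q)) in h2; [|nra].
    refine (Rle_trans _ _ _ _ (Rle_trans _ _ _ (Rplus_le_compat _ _ _ _ h1 h2) _));
      right; unfold A, B; field; lra.
Qed.

End Conv.

(** * The Laplace convolution *)

Section ConvAlgebra.

Context {s : scalars}.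
Notation K := (Sc s).

Lemma is_RInt_gen_conv (f g : R -> K) (t : R) : regular f -> regular g -> 0 < t ->
  is_RInt_gen (fun x => smul s (f x) (g (t - x))) (at_right 0) (at_left t) (conv f g t).
Proof.
  intros [p [Hp [Cf Wf]]] [q [Hq [Cg Wg]]] Ht.
  destruct (Wf t Ht) as [M [HM WM]], (Wg t Ht) as [N [HN WN]].
  destruct (is_RInt_gen_conv_le Hp Hq Ht HM HN (f := f) (g := g)) as [l [Hl _]]; auto.
  - intros x Hx; apply Cf; lra.
  - intros x Hx; apply Cg; lra.
  - now rewrite (@conv_unique s f g t l Hl).
Qed.

Lemma norm_conv_le (p q t M N : R) (f g : R -> K) :
  0 < p <= 1 -> 0 < q <= 1 -> 0 < t -> 0 <= M -> 0 <= N ->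
  (forall x, 0 < x < t -> continuous f x) -> (forall x, 0 < x < t -> continuous g x) ->
  weight_le p t M f -> weight_le q t N g ->
  norm (conv f g t) <= M * N * (2 / p + 2 / q) * Rpower t (p + q - 1).
Proof.
  intros Hp Hq Ht HM HN Cf Cg Wf Wg.
  destruct (is_RInt_gen_conv_le Hp Hq Ht HM HN Cf Cg Wf Wg) as [l [Hl Nl]].
  now rewrite (@conv_unique s f g t l Hl).
Qed.

(** On (0,T] the surplus power t^(p-p') is at most T^(p-p'), which goes into the constant. This
    gives two functions a common exponent. *)
Lemma weight_le_weaken (p p' T M : R) (f : R -> K) : 0 < T -> p' <= p -> 0 <= M ->
  weight_le p T M f -> weight_le p' T (M * Rpower T (p - p')) f.
Proof.
  intros HT Hp HM Hf t Ht; apply Rle_trans with (1 := Hf t Ht).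
  replace (p - 1) with ((p - p') + (p' - 1)) by ring; rewrite Rpower_plus Rmult_assoc.
  apply Rmult_le_compat_l; [lra|]; apply Rmult_le_compat_r.
  - left; apply Rpower_gt_0.
  - apply Rle_Rpower_l; lra.
Qed.

Lemma regular_at_weaken (p p' : R) (f : R -> K) :
  p' <= p -> regular_at p f -> regular_at p' f.
Proof.
  intros Hp [Cf Wf]; split; auto; intros T HT; destruct (Wf T HT) as [M [HM WM]].
  exists (M * Rpower T (p - p')); split.
  - apply Rmult_le_pos; auto; left; apply Rpower_gt_0.
  - now apply weight_le_weaken.
Qed.

Lemma regular_continuous (f : R -> K) t : regular f -> 0 < t -> continuous f t.
Proof. intros [p [_ [C _]]]; apply C. Qed.

Lemma regular_ext (f g : R -> K) :
  (forall t, 0 < t -> f t = g t) -> regular f -> regular g.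
Proof.
  intros E [p [Hp [C W]]]; exists p; split; auto; split.
  - intros t Ht; apply continuous_ext_loc with (2 := C t Ht).
    exists (mkposreal t Ht); intros y Hy; apply E.
    move: Hy; rewrite /ball /= /AbsRing_ball /= /abs /minus /plus /opp /=.
    move/Rabs_def2; lra.
  - intros T HT; destruct (W T HT) as [M [HM WM]]; exists M; split; auto.
    intros t Ht; rewrite -E; [|lra]; now apply WM.
Qed.

Lemma regular_at_linear (L : K -> K) p (f : R -> K) :
  is_linear L -> regular_at p f -> regular_at p (fun t => L (f t)).
Proof.
  intros HL [C W]; split.
  - intros t Ht; apply (continuous_comp f L); [now apply C|].
    exact: linear_cont.
  - intros T HT; destruct (W T HT) as [M [HM WM]], (linear_norm _ HL) as [N [HN WN]].
    exists (N * M); split; [nra|]; intros t Ht.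
    apply Rle_trans with (1 := WN _); rewrite Rmult_assoc.
    apply Rmult_le_compat_l; [lra | now apply WM].
Qed.

Lemma regular_at_plus p (f g : R -> K) :
  regular_at p f -> regular_at p g -> regular_at p (fun t => plus (f t) (g t)).
Proof.
  intros [Cf Wf] [Cg Wg]; split.
  - intros t Ht; apply: continuous_plus; auto.
  - intros T HT; destruct (Wf T HT) as [M [HM WM]], (Wg T HT) as [N [HN WN]].
    exists (M + N); split; [lra|]; intros t Ht.
    apply Rle_trans with (1 := norm_triangle (f t) (g t)); rewrite Rmult_plus_distr_r.
    apply Rplus_le_compat; auto.
Qed.

Lemma regular_linear (L : K -> K) (f : R -> K) :
  is_linear L -> regular f -> regular (fun t => L (f t)).
Proof.
  intros HL [p [Hp Hf]]; exists p; split; auto; now apply regular_at_linear.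
Qed.

Lemma regular_plus (f g : R -> K) :
  regular f -> regular g -> regular (fun t => plus (f t) (g t)).
Proof.
  intros [p [Hp Hf]] [q [Hq Hg]]; exists (Rmin p q); split.
  { split; [apply Rmin_glb_lt; lra|]; pose proof (Rmin_l p q); lra. }
  apply regular_at_plus; [apply regular_at_weaken with p | apply regular_at_weaken with q];
    auto; [apply Rmin_l | apply Rmin_r].
Qed.

Lemma regular_opp (f : R -> K) : regular f -> regular (fun t => opp (f t)).
Proof. apply regular_linear; exact is_linear_opp. Qed.

Lemma regular_minus (f g : R -> K) :
  regular f -> regular g -> regular (fun t => minus (f t) (g t)).
Proof. intros Hf Hg; apply regular_plus; auto; now apply regular_opp. Qed.

Lemma conv_comm (f g : R -> K) (t : R) : regular f -> regular g -> 0 < t ->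
  conv f g t = conv g f t.
Proof.
  intros Hf Hg Ht; apply conv_unique.
  generalize (is_RInt_gen_reflect (is_RInt_gen_conv Hg Hf Ht)).
  apply is_RInt_gen_ext; apply filter_forall; intros xy x _.
  rewrite smul_comm; repeat f_equal; ring.
Qed.

Lemma conv_plus_l (f g u : R -> K) (t : R) :
  regular f -> regular g -> regular u -> 0 < t ->
  conv (fun x => plus (f x) (g x)) u t = plus (conv f u t) (conv g u t).
Proof.
  intros Hf Hg Hu Ht; apply conv_unique.
  generalize (is_RInt_gen_plus _ _ _ _ (is_RInt_gen_conv Hf Hu Ht) (is_RInt_gen_conv Hg Hu Ht)).
  apply is_RInt_gen_ext; apply filter_forall; intros xy x _.
  now rewrite smul_plus_l.
Qed.

(** The second condition says that L commutes with multiplication by scalars of K. Both negation and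
    multiplication by a constant are instances. *)
Lemma conv_linear_l (L : K -> K) (f u : R -> K) (t : R) :
  is_linear L -> (forall a b, L (smul s a b) = smul s (L a) b) ->
  regular f -> regular u -> 0 < t ->
  conv (fun x => L (f x)) u t = L (conv f u t).
Proof.
  intros HL HL' Hf Hu Ht; apply conv_unique.
  generalize (is_RInt_gen_linear HL (is_RInt_gen_conv Hf Hu Ht)).
  apply is_RInt_gen_ext; apply filter_forall; intros xy x _; apply HL'.
Qed.

Lemma conv_smul_l (c : K) (f u : R -> K) (t : R) : regular f -> regular u -> 0 < t ->
  conv (fun x => smul s c (f x)) u t = smul s c (conv f u t).
Proof.
  intros; apply (@conv_linear_l (smul s c)); auto; [apply is_linear_smul|].
  intros; now rewrite smul_assoc.
Qed.

Lemma conv_opp_l (f u : R -> K) (t : R) : regular f -> regular u -> 0 < t ->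
  conv (fun x => opp (f x)) u t = opp (conv f u t).
Proof.
  intros; apply (@conv_linear_l (fun x => opp x)); auto; [exact is_linear_opp|].
  intros a b; rewrite !(fun x => smul_comm x b).
  symmetry; apply (linear_opp (smul s b) a), is_linear_smul.
Qed.

Lemma conv_minus_l (f g u : R -> K) (t : R) :
  regular f -> regular g -> regular u -> 0 < t ->
  conv (fun x => minus (f x) (g x)) u t = minus (conv f u t) (conv g u t).
Proof.
  intros; unfold minus; rewrite conv_plus_l ?conv_opp_l; auto; now apply regular_opp.
Qed.

Lemma conv_plus_r (f g u : R -> K) (t : R) :
  regular f -> regular g -> regular u -> 0 < t ->
  conv u (fun x => plus (f x) (g x)) t = plus (conv u f t) (conv u g t).
Proof.
  intros; rewrite !(conv_comm (f := u)) //; [now apply conv_plus_l | now apply regular_plus].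
Qed.

Lemma conv_minus_r (f g u : R -> K) (t : R) :
  regular f -> regular g -> regular u -> 0 < t ->
  conv u (fun x => minus (f x) (g x)) t = minus (conv u f t) (conv u g t).
Proof.
  intros; rewrite !(conv_comm (f := u)) //; [now apply conv_minus_l | now apply regular_minus].
Qed.

(** The factor f1 is continuous only relative to [0,+oo). Composing it with [Rmax 0] makes it
    continuous everywhere, so that it is bounded on [0,T] in the ordinary way. *)
Lemma continuous_on_clamp (f : R -> K) : continuous_on (fun x => 0 <= x) f ->
  forall x, continuous (fun t => f (Rmax 0 t)) x.
Proof.
  intros Hf x P HP.
  assert (Hm : 0 <= Rmax 0 x) by apply Rmax_l.
  destruct (Hf _ Hm P HP) as [e He]; exists e; intros y Hy; apply He; [|apply Rmax_l].
  move: Hy; rewrite /ball /= /AbsRing_ball /= /abs /minus /plus /opp /=.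
  move/Rabs_def2=> Hy; apply Rabs_def1; unfold Rmax;
    destruct (Rle_dec 0 x), (Rle_dec 0 y); lra.
Qed.

Lemma C_m1_regular (f : R -> K) : C_m1 f -> regular f.
Proof.
  intros [p [Hp [f1 [Cf1 E]]]].
  assert (Hat : regular_at p f).
  { split.
    - intros t Ht.
      apply continuous_ext_loc with (fun t => scal (Rpower t (p - 1)) (f1 (Rmax 0 t))).
      { exists (mkposreal t Ht); intros y Hy.
        move: Hy; rewrite /ball /= /AbsRing_ball /= /abs /minus /plus /opp /=.
        move/Rabs_def2=> Hy; rewrite E; [|lra]; rewrite Rmax_right; [reflexivity|lra]. }
      apply: (continuous_scal (fun t => Rpower t (p - 1)) (fun t => f1 (Rmax 0 t)));
        [now apply continuous_Rpower | now apply continuous_on_clamp].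
    - intros T HT.
      destruct (bounded_continuity (fun t => f1 (Rmax 0 t)) 0 T) as [M HM].
      { intros x _; now apply continuous_on_clamp. }
      assert (0 <= M).
      { left; apply Rle_lt_trans with (2 := HM 0 ltac:(lra)); apply norm_ge_0. }
      exists M; split; auto; intros t Ht; rewrite E; [|lra].
      apply Rle_trans with (1 := norm_scal (Rpower t (p - 1)) (f1 t)).
      rewrite Rmult_comm; apply Rmult_le_compat; try apply norm_ge_0; try apply Rabs_pos.
      + left; specialize (HM t ltac:(lra)); rewrite Rmax_right in HM; lra.
      + right; apply Rabs_pos_eq; left; apply Rpower_gt_0. }
  exists (Rmin p 1); split.
  - split; [apply Rmin_glb_lt; lra | apply Rmin_r].
  - apply regular_at_weaken with p; auto; apply Rmin_l.
Qed.

(** The quotient of f by t^(p-1) is bounded near 0 but may oscillate. With p/2 in place of p the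
    quotient is at most M t^(p/2), so its extension by 0 is continuous. *)
Lemma regular_C_m1 (f : R -> K) : regular f -> C_m1 f.
Proof.
  intros [p [Hp [C W]]]; exists (p / 2); split; [lra|].
  set q := p / 2.
  exists (fun t => if Rle_dec t 0 then zero else scal (Rpower t (1 - q)) (f t)); split.
  - intros x Hx; destruct (Rle_lt_dec x 0) as [H|H].
    + refine (proj2 (filterlim_locally_ball_norm (U := Sc s) _ _) _); intros eps.
      destruct (W 1 Rlt_0_1) as [M [HM WM]].
      assert (Hq : 0 < q) by (unfold q; lra).
      (* M may be 0; adding 1 keeps the quotient meaningful and the final inequality strict. *)
      assert (He : 0 < eps / (M + 1)) by (apply Rdiv_lt_0_compat; [apply cond_pos | lra]).
      assert (Hd : 0 < Rmin 1 (Rpower (eps / (M + 1)) (/ q)))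
        by (apply Rmin_glb_lt; [lra | apply Rpower_gt_0]).
      exists (mkposreal _ Hd); intros y Hy Hy0; replace x with 0 in * by lra.
      move: Hy; rewrite /ball /= /AbsRing_ball /= /abs /minus /plus /opp /=.
      move/Rabs_def2=> Hy; rewrite /ball_norm.
      destruct (Rle_dec 0 0) as [_|]; [|lra].
      destruct (Rle_dec y 0) as [Hy1|Hy1].
      { rewrite minus_eq_zero norm_zero; apply cond_pos. }
      rewrite /minus opp_zero plus_zero_r.
      apply Rle_lt_trans with (1 := norm_scal (Rpower y (1 - q)) (f y)).
      pose proof (Rmin_l 1 (Rpower (eps / (M + 1)) (/ q))).
      pose proof (Rmin_r 1 (Rpower (eps / (M + 1)) (/ q))).
      assert (Nf : norm (f y) <= M * Rpower y (p - 1)) by (apply WM; lra).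
      assert (Hs : Rpower y q < eps / (M + 1)) by (apply Rpower_lt_radius; lra).
      rewrite /abs /= Rabs_pos_eq; [|left; apply Rpower_gt_0].
      apply Rle_lt_trans with (Rpower y (1 - q) * (M * Rpower y (p - 1))).
      { apply Rmult_le_compat_l; auto; left; apply Rpower_gt_0. }
      replace (Rpower y (1 - q) * (M * Rpower y (p - 1))) with (M * Rpower y q).
      2: { replace q with ((1 - q) + (p - 1)) at 1 by (unfold q; field).
           rewrite Rpower_plus; ring. }
      apply Rle_lt_trans with (M * (eps / (M + 1))); [nra|].
      apply Rlt_le_trans with ((M + 1) * (eps / (M + 1))); [nra|].
      right; field; lra.
    + intros P HP.
      assert (HC : continuous (fun t => scal (Rpower t (1 - q)) (f t)) x).
      { apply: (continuous_scal (fun t => Rpower t (1 - q)) f);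
          [now apply continuous_Rpower | now apply C]. }
      destruct (Rle_dec x 0) as [|_]; [lra|].
      specialize (HC P HP); revert HC; unfold filtermap, within.
      intros [e He].
      assert (Hd : 0 < Rmin e x) by (apply Rmin_glb_lt; [apply cond_pos | lra]).
      exists (mkposreal _ Hd); intros y Hy _.
      assert (H1 := Rmin_l e x); assert (H2 := Rmin_r e x).
      move: (Hy); rewrite /ball /= /AbsRing_ball /= /abs /minus /plus /opp /=.
      move/Rabs_def2=> Hy'.
      destruct (Rle_dec y 0) as [|_]; [lra|]; apply He.
      apply ball_le with (2 := Hy); exact H1.
  - intros t Ht; destruct (Rle_dec t 0) as [|_]; [lra|].
    rewrite scal_assoc /mult /= -Rpower_plus.
    replace (q - 1 + (1 - q)) with 0 by ring; rewrite Rpower_O; auto.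
    now rewrite (scal_one (K := R_AbsRing)).
Qed.

End ConvAlgebra.

(** * Iterated integrals *)

Lemma Rabs_dist_le_between (a b x : R) :
  Rmin a b <= x <= Rmax a b -> Rabs (x - a) <= Rabs (b - a).
Proof.
  unfold Rmin, Rmax, Rabs; destruct (Rle_dec a b), (Rcase_abs (x - a)), (Rcase_abs (b - a)); lra.
Qed.

Section Fubini.

Context {V : CompleteNormedModule R_AbsRing}.

(** Uniform continuity on the strip is applied to the real function [norm (minus (H x y) (H x0 y))],
    which vanishes at x = x0. *)
Lemma uniformly_close_slices (H : R -> R -> V) (x0 c d eps : R) :
  (forall z : R * R, continuous (fun z => H (fst z) (snd z)) z) -> 0 < eps ->
  exists delta, 0 < delta /\ forall x y, Rabs (x - x0) < delta -> c <= y <= d ->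
    norm (minus (H x y) (H x0 y)) < eps.
Proof.
  intros HC He.
  destruct (uniform_continuity_2d_1d (fun y x => norm (minus (H x y) (H x0 y)))
    c d x0) with (eps := mkposreal eps He) as [delta Hd].
  - intros y _; apply continuity_2d_pt_filterlim.
    assert (C : continuous (fun z : R * R => norm (minus (H (snd z) (fst z)) (H x0 (fst z))))
      (y, x0)).
    { apply (continuous_comp (fun z : R * R => minus (H (snd z) (fst z)) (H x0 (fst z)))
        (fun v => norm v)); [|apply: filterlim_norm].
      apply: continuous_minus.
      - apply (continuous_comp (fun z : R * R => (snd z, fst z))
          (fun z : R * R => H (fst z) (snd z))); [|apply HC].
        apply (continuous_comp_2 (fun z : R * R => snd z) (fun z => fst z) pair);
          [apply continuous_snd | apply continuous_fst |].
        apply continuous_ext with (fun z => z); [now intros [] | apply continuous_id].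
      - apply (continuous_comp (fun z : R * R => (x0, fst z))
          (fun z : R * R => H (fst z) (snd z))); [|apply HC].
        apply (continuous_comp_2 (fun z : R * R => x0) (fun z => fst z) pair);
          [apply continuous_const | apply continuous_fst |].
        apply continuous_ext with (fun z => z); [now intros [] | apply continuous_id]. }
    exact C.
  - exists delta; split; [apply cond_pos|]; intros x y Hx Hy.
    assert (Hx' := Rabs_def2 _ _ Hx).
    pose proof (cond_pos delta).
    specialize (Hd y x0 y x Hy ltac:(lra) Hy ltac:(lra)).
    rewrite Rminus_diag Rabs_R0 in Hd; specialize (Hd ltac:(lra)).
    rewrite minus_eq_zero norm_zero Rminus_0_r in Hd.
    apply Rle_lt_trans with (1 := Rle_abs _); exact Hd.
Qed.

Lemma continuous_slice (H : R -> R -> V) x y :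
  (forall z : R * R, continuous (fun z => H (fst z) (snd z)) z) -> continuous (H x) y.
Proof.
  intros HC; apply (continuous_comp (fun y => (x, y)) (fun z : R * R => H (fst z) (snd z)));
    [|apply HC].
  apply (continuous_comp_2 (fun _ : R => x) (fun y => y) pair);
    [apply continuous_const | apply continuous_id |].
  apply continuous_ext with (fun z => z); [now intros [] | apply continuous_id].
Qed.

Lemma continuous_swap (H : R -> R -> V) :
  (forall z : R * R, continuous (fun z => H (fst z) (snd z)) z) ->
  forall z : R * R, continuous (fun z => H (snd z) (fst z)) z.
Proof.
  intros HC z; apply (continuous_comp (fun z : R * R => (snd z, fst z))
    (fun z : R * R => H (fst z) (snd z))); [|apply HC].
  apply (continuous_comp_2 (fun z : R * R => snd z) (fun z => fst z) pair);
    [apply continuous_snd | apply continuous_fst |].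
  apply continuous_ext with (fun z => z); [now intros [] | apply continuous_id].
Qed.

Lemma is_RInt_slice (H : R -> R -> V) x a b :
  (forall z : R * R, continuous (fun z => H (fst z) (snd z)) z) ->
  is_RInt (H x) a b (RInt (H x) a b).
Proof.
  intros HC; apply (RInt_correct (H x)), (ex_RInt_continuous (H x)).
  intros z _; now apply continuous_slice.
Qed.

Lemma continuous_RInt_param (H : R -> R -> V) (x0 c d : R) :
  (forall z : R * R, continuous (fun z => H (fst z) (snd z)) z) ->
  continuous (fun x => RInt (H x) c d) x0.
Proof.
  intros HC; apply (proj2 (continuous_eps (V := V) _ _)); intros eps He.
  set e := eps / (Rabs (d - c) + 1).
  pose proof (Rabs_pos (d - c)).
  assert (He' : 0 < e) by (apply Rdiv_lt_0_compat; lra).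
  destruct (uniformly_close_slices H x0 (Rmin c d) (Rmax c d) HC He') as [delta [Hd Hs]].
  exists delta; split; auto; intros x Hx.
  apply Rle_lt_trans with (Rabs (d - c) * e).
  - apply (norm_RInt_le_const_abs (fun y => minus (H x y) (H x0 y)) c d).
    + intros y Hy; left; now apply Hs.
    + apply: is_RInt_minus; now apply is_RInt_slice.
  - apply Rlt_le_trans with ((Rabs (d - c) + 1) * e); [nra|].
    right; unfold e; field; lra.
Qed.

(** As functions of the end point b both sides have the derivative [RInt (H b) c d], and both vanish
    at b = a. *)
Lemma RInt_exchange (H : R -> R -> V) (a b c d : R) :
  (forall z : R * R, continuous (fun z => H (fst z) (snd z)) z) ->
  RInt (fun x => RInt (H x) c d) a b = RInt (fun y => RInt (fun x => H x y) a b) c d.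
Proof.
  intros HC; pose proof (continuous_swap H HC) as HC'.
  set H' := fun y x => H x y.
  assert (HB : forall x, is_RInt (fun y => RInt (H' y) a x) c d
                                 (RInt (fun y => RInt (H' y) a x) c d)).
  { intros x; apply (RInt_correct (fun y => RInt (H' y) a x)),
      (ex_RInt_continuous (fun y => RInt (H' y) a x)).
    intros y _; now apply continuous_RInt_param. }
  assert (D : forall x, is_derive (fun x => RInt (fun y => RInt (H' y) a x) c d) x
                                  (RInt (H x) c d)).
  { intros x0; split; [apply is_linear_scal_l|].
    intros x Hx; rewrite -(is_filter_lim_locally_unique _ _ Hx); clear x Hx.
    intros eps.
    set e := eps / (Rabs (d - c) + 1).
    pose proof (Rabs_pos (d - c)).
    assert (He' : 0 < e) by (apply Rdiv_lt_0_compat; [apply cond_pos | lra]).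
    destruct (uniformly_close_slices H x0 (Rmin c d) (Rmax c d) HC He') as [delta [Hd Hs]].
    exists (mkposreal delta Hd); intros x Hx.
    (* The remainder of the derivative is the double integral of H u y - H x0 y over u between x0
       and x and y between c and d. *)
    apply Rle_trans with (Rabs (d - c) * (Rabs (x - x0) * e)).
    - apply (norm_RInt_le_const_abs (fun y => minus
        (minus (RInt (H' y) a x) (RInt (H' y) a x0)) (scal (x - x0) (H x0 y))) c d).
      + intros y Hy.
        apply (norm_RInt_le_const_abs (fun u => minus (H u y) (H x0 y)) x0 x).
        * intros u Hu; left; apply Hs; auto.
          apply Rle_lt_trans with (Rabs (x - x0)); [|exact Hx].
          apply Rabs_dist_le_between; lra.
        * apply: is_RInt_minus; [|apply: is_RInt_const].
          assert (E : is_RInt (H' y) x0 x (plus (opp (RInt (H' y) a x0)) (RInt (H' y) a x))).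
          { apply (is_RInt_Chasles (H' y) x0 a x); [apply (is_RInt_swap (H' y))|];
              now apply is_RInt_slice. }
          now rewrite plus_comm in E.
      + apply: is_RInt_minus; [apply: is_RInt_minus; apply HB|].
        apply: is_RInt_scal; now apply is_RInt_slice.
    - apply Rle_trans with (eps * Rabs (x - x0)); [|right; reflexivity].
      pose proof (Rabs_pos (x - x0)).
      apply Rle_trans with ((Rabs (d - c) + 1) * e * Rabs (x - x0)); [nra|].
      right; unfold e; field; lra. }
  apply is_RInt_unique.
  replace (RInt (fun y => RInt (fun x => H x y) a b) c d) with
    (minus (RInt (fun y => RInt (H' y) a b) c d) (RInt (fun y => RInt (H' y) a a) c d)).
  - apply (is_RInt_derive (fun x => RInt (fun y => RInt (H' y) a x) c d)).
    + intros; apply D.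
    + intros; now apply continuous_RInt_param.
  - assert (Z : RInt (fun y => RInt (H' y) a a) c d = zero).
    { apply is_RInt_unique.
      apply is_RInt_ext with (fun _ => zero).
      - intros; symmetry; apply (RInt_point a (H' x)).
      - generalize (is_RInt_const c d (zero : V)); now rewrite scal_zero_r. }
    rewrite Z /minus opp_zero plus_zero_r; reflexivity.
Qed.

End Fubini.

(** * Approximation by causal continuous functions *)

Section Associativity.

Context {s : scalars}.
Notation K := (Sc s).

Definition causal (f : R -> K) : Prop :=
  (forall t, continuous f t) /\ forall t, t <= 0 -> f t = zero.

Lemma regular_of_continuous (f : R -> K) : (forall t, continuous f t) -> regular f.
Proof.
  intros C; exists 1; split; [lra|]; split; auto.
  intros T HT; destruct (bounded_continuity f 0 T) as [M HM]; [intros; apply C|].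
  exists M; split.
  - left; apply Rle_lt_trans with (2 := HM 0 ltac:(lra)); apply norm_ge_0.
  - intros t Ht; rewrite Rminus_diag Rpower_O; [|lra].
    rewrite Rmult_1_r; left; apply HM; lra.
Qed.

Lemma continuous_conv_integrand (f g : R -> K) :
  (forall t, continuous f t) -> (forall t, continuous g t) ->
  forall z : R * R, continuous (fun z => smul s (f (snd z)) (g (fst z - snd z))) z.
Proof.
  intros Hf Hg z; apply: continuous_smul.
  - apply (continuous_comp (fun z : R * R => snd z) f); [apply continuous_snd | apply Hf].
  - apply (continuous_comp (fun z : R * R => fst z - snd z) g); [|apply Hg].
    apply (continuous_minus (V := R_NormedModule));
      [apply continuous_fst | apply continuous_snd].
Qed.

(** As g vanishes on (-oo,0], the integrand is zero for x > t. The upper limit can thus be fixed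
    independently of t, and t remains only as a parameter of the integrand. *)
Lemma conv_causal (f g : R -> K) (t T : R) :
  (forall x, continuous f x) -> causal g -> 0 < t <= T ->
  conv f g t = RInt (fun x => smul s (f x) (g (t - x))) 0 T.
Proof.
  intros Hf [Cg Zg] Ht.
  set H := fun t x => smul s (f x) (g (t - x)).
  pose proof (continuous_conv_integrand Hf Cg) as HC.
  transitivity (RInt (H t) 0 t).
  - apply conv_unique, (is_RInt_gen_continuous (f := H t)); [lra|].
    intros x; now apply (continuous_slice H).
  - symmetry; apply is_RInt_unique; rewrite -(plus_zero_r (RInt (H t) 0 t)).
    apply (is_RInt_Chasles (H t) 0 t T); [now apply (is_RInt_slice H)|].
    apply is_RInt_ext with (fun _ => zero).
    + intros x; rewrite Rmin_left ?Rmax_right; try lra; intros Hx.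
      unfold H; rewrite (Zg (t - x)); [|lra]; now rewrite smul_comm smul_zero_l.
    + generalize (is_RInt_const t T (zero : K)); now rewrite scal_zero_r.
Qed.

(** Both sides are iterated integrals of f(x) g(y-x) u(t-y) over the square [0,t]^2: causality of g
    extends the triangle x <= y by zero. *)
Lemma conv_assoc_causal (f g u : R -> K) (t : R) :
  causal f -> causal g -> causal u -> 0 < t ->
  conv (conv f g) u t = conv f (conv g u) t.
Proof.
  intros [Cf Zf] Hg Hu Ht.
  destruct Hg as [Cg Zg], Hu as [Cu Zu].
  set H := fun y x => smul s (smul s (f x) (g (y - x))) (u (t - y)).
  assert (HC : forall z : R * R, continuous (fun z => H (fst z) (snd z)) z).
  { intros z; apply: continuous_smul; [now apply continuous_conv_integrand|].
    apply (continuous_comp (fun z : R * R => t - fst z) u); [|apply Cu].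
    apply (continuous_minus (V := R_NormedModule));
      [apply continuous_const | apply continuous_fst]. }
  pose proof (continuous_conv_integrand Cf Cg) as Cfg.
  transitivity (RInt (fun y => RInt (H y) 0 t) 0 t).
  { set v := fun y => RInt (fun x => smul s (f x) (g (y - x))) 0 t.
    assert (Cv : forall y, continuous v y).
    { intros y; now apply (continuous_RInt_param (fun y x => smul s (f x) (g (y - x)))). }
    rewrite (@conv_ext s (conv f g) v u u t); auto.
    2: { intros x Hx; apply (conv_causal Cf (conj Cg Zg)); lra. }
    rewrite (conv_causal Cv (conj Cu Zu) (T := t)); [|lra].
    apply RInt_ext; intros y _; unfold v.
    rewrite smul_comm; symmetry; apply is_RInt_unique.
    apply is_RInt_ext with (fun x => smul s (u (t - y)) (smul s (f x) (g (y - x)))).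
    { intros x _; apply smul_comm. }
    apply (is_RInt_linear (is_linear_smul (u (t - y)))).
    now apply (is_RInt_slice (fun y x => smul s (f x) (g (y - x)))). }
  rewrite (RInt_exchange H); [|exact HC].
  set G := fun y x => smul s (g x) (u (y - x)).
  assert (CG : forall z : R * R, continuous (fun z => G (fst z) (snd z)) z)
    by now apply continuous_conv_integrand.
  symmetry; apply conv_unique.
  apply is_RInt_gen_ext with (fun x => RInt (fun y => H y x) 0 t).
  2: { apply (is_RInt_gen_continuous (f := fun x => RInt (fun y => H y x) 0 t)); [lra|].
       intros x; apply (continuous_RInt_param (fun x y => H y x)).
       now apply continuous_swap. }
  generalize (filter_prod_interior Ht); apply filter_imp; move=> [a b] /= Hab x.
  rewrite Rmin_left ?Rmax_right; try lra; intros Hx; apply is_RInt_unique.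
  apply is_RInt_ext with (fun y => smul s (f x) (smul s (g (y - x)) (u (t - y)))).
  { intros y _; unfold H; now rewrite smul_assoc. }
  refine (is_RInt_linear (f := fun y => smul s (g (y - x)) (u (t - y)))
    (is_linear_smul (f x)) _).
  (* The part y < x contributes zero, as g(y-x) = 0 there; on [x,t] the shift y -> y - x produces (g
     * u)(t-x). *)
  rewrite -(plus_zero_l (conv g u (t - x))).
  apply (is_RInt_Chasles (fun y => smul s (g (y - x)) (u (t - y))) 0 x t).
  - apply is_RInt_ext with (fun _ => zero).
    + intros y; rewrite Rmin_left ?Rmax_right; try lra; intros Hy.
      rewrite Zg; [|lra]; now rewrite smul_zero_l.
    + generalize (is_RInt_const 0 x (zero : K)); now rewrite scal_zero_r.
  - rewrite (conv_causal Cg (conj Cu Zu) (T := t - x)); [|lra].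
    apply is_RInt_ext with (fun y => scal 1 (G (t - x) (1 * y + - x))).
    { intros y _; rewrite (scal_one (K := R_AbsRing)); unfold G.
      f_equal; [f_equal; ring | f_equal; ring]. }
    apply (is_RInt_comp_lin (G (t - x)) 1 (- x) x t).
    replace (1 * x + - x) with 0 by ring; replace (1 * t + - x) with (t - x) by ring.
    now apply (is_RInt_slice G).
Qed.

(* Convergence in the norm [sup t^(1-p) |f t|] over each [(0,T]]; convolution by a
   fixed function is continuous for it. *)
Definition weighted_limit (p : R) (F : nat -> R -> K) (f : R -> K) : Prop :=
  forall T eps, 0 < T -> 0 < eps ->
    exists N, forall n, (N <= n)%nat -> weight_le p T eps (fun t => minus (F n t) (f t)).

Lemma weighted_limit_ext p (F G : nat -> R -> K) (f g : R -> K) :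
  (forall n t, 0 < t -> F n t = G n t) -> (forall t, 0 < t -> f t = g t) ->
  weighted_limit p F f -> weighted_limit p G g.
Proof.
  intros EF Ef HF T eps HT He; destruct (HF T eps HT He) as [N HN].
  exists N; intros n Hn t Ht; rewrite -EF -?Ef; try lra; now apply HN.
Qed.

Lemma weighted_limit_unique p q (F : nat -> R -> K) (f g : R -> K) :
  weighted_limit p F f -> weighted_limit q F g -> forall t, 0 < t -> f t = g t.
Proof.
  intros Hf Hg t Ht; apply ball_norm_eq; intros eps.
  (* Dividing by the weight at t makes the weighted bound equal to eps / 4 at this one point. *)
  assert (Q : forall r, 0 < eps / 4 / Rpower t (r - 1)).
  { intros r; pose proof (cond_pos eps); apply Rdiv_lt_0_compat; [lra | apply Rpower_gt_0]. }
  assert (E : forall r, eps / 4 / Rpower t (r - 1) * Rpower t (r - 1) = eps / 4).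
  { intros r; pose proof (Rpower_gt_0 t (r - 1)); field; lra. }
  destruct (Hf t _ Ht (Q p)) as [N1 H1], (Hg t _ Ht (Q q)) as [N2 H2].
  set n := max N1 N2.
  specialize (H1 n ltac:(apply Nat.le_max_l) t ltac:(lra)).
  specialize (H2 n ltac:(apply Nat.le_max_r) t ltac:(lra)).
  rewrite E in H1; rewrite E in H2; pose proof (cond_pos eps).
  replace (pos eps) with (eps / 2 + eps / 2) by field.
  apply ball_norm_triangle with (F n t).
  - apply Rle_lt_trans with (1 := H1); lra.
  - assert (H2' : ball_norm (g t) (eps / 2) (F n t))
      by (apply Rle_lt_trans with (1 := H2); lra).
    exact (ball_norm_sym _ _ (mkposreal (eps / 2) ltac:(lra)) H2').
Qed.

(** For p <= 1 the weight is at most (t/2)^(p-1) on [t/2,2t], so the convergence is uniform there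
    and a uniform limit of continuous functions results. *)
Lemma weighted_limit_continuous p (F : nat -> R -> K) (f : R -> K) t :
  p <= 1 -> weighted_limit p F f -> 0 < t -> (forall n, continuous (F n) t) ->
  continuous f t.
Proof.
  intros Hp HF Ht HC; apply (proj2 (continuous_eps (V := Sc s) _ _)); intros eps He.
  set W := Rpower (t / 2) (p - 1).
  assert (HW : 0 < W) by apply Rpower_gt_0.
  assert (He' : 0 < eps / 4 / W) by (apply Rdiv_lt_0_compat; lra).
  destruct (HF (2 * t) _ ltac:(lra) He') as [n Hn]; specialize (Hn n (le_n n)).
  assert (near : forall y, t / 2 <= y <= 2 * t -> norm (minus (F n y) (f y)) <= eps / 4).
  { intros y Hy; apply Rle_trans with (1 := Hn y ltac:(lra)).
    apply Rle_trans with (eps / 4 / W * W); [|right; field; lra].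
    apply Rmult_le_compat_l; [lra|]; apply Rpower_le_antitone; lra. }
  destruct (proj1 (continuous_eps (V := Sc s) _ _) (HC n) (eps / 4)) as [d [Hd Hc]]; [lra|].
  exists (Rmin d (t / 2)); split; [apply Rmin_glb_lt; lra|]; intros y Hy.
  pose proof (Rmin_l d (t / 2)); pose proof (Rmin_r d (t / 2)).
  pose proof (Rabs_def2 _ _ Hy).
  pose proof (near t ltac:(lra)) as N1; pose proof (near y ltac:(lra)) as N2.
  specialize (Hc y ltac:(lra)).
  replace eps with (eps / 3 + eps / 3 + eps / 3) by field.
  apply (ball_norm_triangle (f t) (F n y) (f y)); [apply ball_norm_triangle with (F n t)|].
  - apply Rle_lt_trans with (1 := N1); lra.
  - apply Rlt_trans with (1 := Hc); lra.
  - apply (ball_norm_sym _ _ (mkposreal (eps / 3) ltac:(lra))).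
    apply Rle_lt_trans with (1 := N2); simpl; lra.
Qed.

(** The bound of [norm_conv_le] carries t^(p+q-1) = t^q t^(p-1), and t^q <= T^q on (0,T]. Hence the
    exponent p of the convergence is preserved. *)
Lemma weighted_limit_conv_l p (F : nat -> R -> K) (f g : R -> K) :
  0 < p <= 1 -> (forall n, regular (F n)) -> regular f -> regular g ->
  weighted_limit p F f -> weighted_limit p (fun n => conv (F n) g) (conv f g).
Proof.
  intros Hp HFr Hf Hg HF T eps HT He.
  destruct (Hg) as [q [Hq [Cg Wg]]]; destruct (Wg T HT) as [N [HN WN]].
  set C := (N + 1) * (2 / p + 2 / q) * Rpower T q.
  assert (HC0 : 0 < 2 / p + 2 / q)
    by (apply Rplus_lt_0_compat; apply Rdiv_lt_0_compat; lra).
  assert (HC : 0 < C).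
  { apply Rmult_lt_0_compat; [apply Rmult_lt_0_compat; lra | apply Rpower_gt_0]. }
  assert (He' : 0 < eps / C) by now apply Rdiv_lt_0_compat.
  destruct (HF T _ HT He') as [n0 Hn0]; exists n0; intros n Hn t Ht.
  rewrite -conv_minus_l; auto; [|lra].
  assert (Hr : regular (fun x => minus (F n x) (f x))) by now apply regular_minus.
  eapply Rle_trans.
  { apply (norm_conv_le (p := p) (q := q) (M := eps / C) (N := N)); try lra.
    - intros x Hx; apply (regular_continuous Hr); lra.
    - intros x Hx; apply Cg; lra.
    - intros x Hx; apply Hn0; auto; lra.
    - intros x Hx; apply WN; lra. }
  replace (p + q - 1) with (q + (p - 1)) by ring; rewrite Rpower_plus -Rmult_assoc.
  apply Rmult_le_compat_r; [left; apply Rpower_gt_0|].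
  apply Rle_trans with (eps / C * C); [|right; field; lra].
  rewrite 2!Rmult_assoc; apply Rmult_le_compat_l; [lra|].
  unfold C; rewrite Rmult_assoc; apply Rmult_le_compat; try lra.
  - apply Rmult_le_pos; [lra | left; apply Rpower_gt_0].
  - apply Rmult_le_compat_l; [lra|]; apply Rle_Rpower_l; lra.
Qed.

Lemma weighted_limit_conv_r p (F : nat -> R -> K) (f g : R -> K) :
  0 < p <= 1 -> (forall n, regular (F n)) -> regular f -> regular g ->
  weighted_limit p F f -> weighted_limit p (fun n => conv g (F n)) (conv g f).
Proof.
  intros Hp HFr Hf Hg HF.
  apply weighted_limit_ext with (3 := weighted_limit_conv_l Hp HFr Hf Hg HF);
    intros; now apply conv_comm.
Qed.

(* The ramp [min 1 ((n+1) t)] removes the singularity at 0 at the price of half the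
   exponent in the norm of convergence. *)
Definition cutoff (n : nat) (f : R -> K) : R -> K :=
  fun t => if Rle_dec t 0 then zero else scal (Rmin 1 (t * INR (S n))) (f t).

Lemma norm_cutoff_le n (f : R -> K) t : norm (cutoff n f t) <= norm (f t).
Proof.
  unfold cutoff; destruct (Rle_dec t 0) as [|H].
  - rewrite norm_zero; apply norm_ge_0.
  - apply Rle_trans with (Rabs (Rmin 1 (t * INR (S n))) * norm (f t));
      [exact (norm_scal (Rmin 1 (t * INR (S n))) (f t))|].
    rewrite -{2}(Rmult_1_l (norm (f t))); apply Rmult_le_compat_r; [apply norm_ge_0|].
    pose proof (lt_0_INR (S n) (Nat.lt_0_succ n)).
    rewrite Rabs_pos_eq; [apply Rmin_l|].
    apply Rmin_glb; [lra | nra].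
Qed.

(** Near 0 the ramp contributes a factor (n+1) t, so the product is at most M (n+1) t^p and tends to
    0. *)
Lemma causal_cutoff n (f : R -> K) : regular f -> causal (cutoff n f).
Proof.
  intros [p [Hp [C W]]]; split.
  - intros t; destruct (Rlt_le_dec 0 t) as [Ht|Ht].
    + apply continuous_ext_loc with (fun t => scal (Rmin 1 (t * INR (S n))) (f t)).
      { exists (mkposreal t Ht); intros y Hy.
        move: Hy; rewrite /ball /= /AbsRing_ball /= /abs /minus /plus /opp /=.
        move/Rabs_def2=> Hy; unfold cutoff; destruct (Rle_dec y 0); [lra | reflexivity]. }
      apply: (continuous_scal (fun t => Rmin 1 (t * INR (S n))) f); [|now apply C].
      apply (continuous_comp (fun t => t * INR (S n)) (Rmin 1)).
      * apply (continuous_scal_l (fun t => t) (INR (S n) : R_NormedModule)), continuous_id.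
      * apply (proj2 (continuous_eps (V := R_NormedModule) _ _)); intros eps He.
        exists eps; split; auto; intros y Hy; apply Rle_lt_trans with (2 := Hy).
        rewrite /norm /minus /plus /opp /= /abs /=.
        unfold Rmin, Rabs; set x := t * _.
        destruct (Rle_dec 1 y), (Rle_dec 1 x), (Rcase_abs (y - x));
          destruct (Rcase_abs _); lra.
    + apply (proj2 (continuous_eps (V := Sc s) _ _)); intros eps He.
      destruct (W 1 Rlt_0_1) as [M [HM WM]].
      pose proof (lt_0_INR (S n) (Nat.lt_0_succ n)) as Hn.
      set A := (M + 1) * INR (S n).
      assert (HA : 0 < A) by (apply Rmult_lt_0_compat; lra).
      assert (Hd : 0 < Rmin 1 (Rpower (eps / A) (/ p)))
        by (apply Rmin_glb_lt; [lra | apply Rpower_gt_0]).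
      pose proof (Rmin_l 1 (Rpower (eps / A) (/ p))).
      pose proof (Rmin_r 1 (Rpower (eps / A) (/ p))).
      eexists; split; [exact Hd|]; intros y Hy; apply Rabs_def2 in Hy.
      unfold cutoff; destruct (Rle_dec t 0) as [_|]; [|lra].
      destruct (Rle_dec y 0) as [Hy0|Hy0].
      { rewrite minus_eq_zero norm_zero; lra. }
      rewrite /minus opp_zero plus_zero_r.
      apply Rle_lt_trans with (Rabs (Rmin 1 (y * INR (S n))) * norm (f y));
        [exact (norm_scal (Rmin 1 (y * INR (S n))) (f y))|].
      assert (Nf : norm (f y) <= M * Rpower y (p - 1)) by (apply WM; lra).
      assert (Hp' : Rpower y p < eps / A).
      { apply Rpower_lt_radius; try lra. now apply Rdiv_lt_0_compat. }
      assert (Ey : Rpower y p = y * Rpower y (p - 1)).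
      { rewrite -{2}(Rpower_1 y); [|lra]; rewrite -Rpower_plus; f_equal; ring. }
      assert (0 <= Rmin 1 (y * INR (S n)) <= y * INR (S n)).
      { split; [apply Rmin_glb; nra | apply Rmin_r]. }
      rewrite Rabs_pos_eq; [|lra].
      apply Rle_lt_trans with (y * INR (S n) * (M * Rpower y (p - 1))).
      { apply Rmult_le_compat; try lra; apply norm_ge_0. }
      replace (y * INR (S n) * (M * Rpower y (p - 1))) with (M * INR (S n) * Rpower y p)
        by (rewrite Ey; ring).
      pose proof (Rpower_gt_0 y p).
      apply Rle_lt_trans with (A * Rpower y p).
      { apply Rmult_le_compat_r; [lra|]; unfold A; nra. }
      apply Rlt_le_trans with (A * (eps / A)); [nra | right; field; lra].
  - intros t Ht; unfold cutoff; destruct (Rle_dec t 0); [reflexivity | lra].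
Qed.

Lemma regular_cutoff n (f : R -> K) : regular f -> regular (cutoff n f).
Proof. intros Hf; apply regular_of_continuous; now apply causal_cutoff. Qed.

(** Where t (n+1) >= 1 nothing changes. Elsewhere t < 1/N and the error is at most 2 M t^(p-1) = 2 M
    t^(p/2) t^(p/2-1), whose factor t^(p/2) is small. *)
Lemma cutoff_limit (f : R -> K) : regular f ->
  exists p, 0 < p <= 1 /\ weighted_limit p (fun n => cutoff n f) f.
Proof.
  intros [p [Hp [C W]]]; exists (p / 2); split; [lra|].
  intros T eps HT He; destruct (W T HT) as [M [HM WM]].
  assert (He' : 0 < eps / (2 * M + 1)) by (apply Rdiv_lt_0_compat; lra).
  destruct (archimed_cor1 (Rpower (eps / (2 * M + 1)) (/ (p / 2)))) as [N [HN1 HN2]];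
    [apply Rpower_gt_0|].
  exists N; intros n Hn t Ht.
  assert (HnS : INR N < INR (S n)) by (apply lt_INR; lia).
  assert (HN0 : 0 < INR N) by now apply lt_0_INR.
  destruct (Rle_lt_dec 1 (t * INR (S n))) as [H1|H1].
  - unfold cutoff; destruct (Rle_dec t 0) as [|_]; [lra|].
    rewrite Rmin_left; auto.
    rewrite (scal_one (K := R_AbsRing)) minus_eq_zero norm_zero.
    apply Rmult_le_pos; [lra | left; apply Rpower_gt_0].
  - apply Rle_trans with (norm (cutoff n f t) + norm (f t)).
    { apply Rle_trans with (1 := norm_triangle (cutoff n f t) (opp (f t))).
      right; f_equal; exact (norm_opp (f t)). }
    pose proof (norm_cutoff_le n f t); pose proof (WM t Ht).
    assert (Hs : t < / INR N).
    { apply Rmult_lt_reg_r with (INR N); auto; rewrite Rinv_l; nra. }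
    assert (Hp2 : Rpower t (p / 2) < eps / (2 * M + 1)) by (apply Rpower_lt_radius; lra).
    apply Rle_trans with (2 * M * Rpower t (p - 1)); [lra|].
    replace (p - 1) with (p / 2 + (p / 2 - 1)) by field; rewrite Rpower_plus -Rmult_assoc.
    apply Rmult_le_compat_r; [left; apply Rpower_gt_0|].
    pose proof (Rpower_gt_0 t (p / 2)).
    apply Rle_trans with ((2 * M + 1) * (eps / (2 * M + 1))); [nra | right; field; lra].
Qed.

(** For continuity the cutoffs are removed in two successive limits, one for each factor; what
    remains is a proper integral depending on a parameter. *)
Lemma regular_conv (f g : R -> K) : regular f -> regular g -> regular (conv f g).
Proof.
  intros Hf Hg.
  assert (Hc : forall t, 0 < t -> continuous (conv f g) t).
  { destruct (cutoff_limit Hf) as [p [Hp HF]], (cutoff_limit Hg) as [q [Hq HG]].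
    intros t Ht.
    apply (weighted_limit_continuous (p := p) (F := fun n => conv (cutoff n f) g)); [lra | | auto |].
    { apply weighted_limit_conv_l; auto; intros; now apply regular_cutoff. }
    intros n.
    apply (weighted_limit_continuous (p := q) (F := fun m => conv (cutoff n f) (cutoff m g)));
      [lra | | auto |].
    { apply weighted_limit_conv_r; auto; intros; now apply regular_cutoff. }
    intros m; destruct (causal_cutoff n Hf) as [C1 Z1]; pose proof (causal_cutoff m Hg) as C2.
    revert C1 Z1 C2; generalize (cutoff n f) (cutoff m g); intros F G C1 Z1 C2.
    (* The upper limit 2 t is valid for all y in (0,2t), a neighbourhood of t. *)
    apply continuous_ext_loc with (fun y => RInt (fun x => smul s (F x) (G (y - x))) 0 (2 * t)).
    { exists (mkposreal t Ht); intros y Hy.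
      move: Hy; rewrite /ball /= /AbsRing_ball /= /abs /minus /plus /opp /=.
      move/Rabs_def2=> Hy; symmetry; apply (conv_causal C1 C2); lra. }
    apply (continuous_RInt_param (fun y x => smul s (F x) (G (y - x)))).
    apply continuous_conv_integrand; [exact C1 | apply C2]. }
  destruct Hf as [p [Hp [Cf Wf]]], Hg as [q [Hq [Cg Wg]]].
  (* The natural exponent p + q may exceed 1, so the smaller p is kept. *)
  exists p; split; auto; apply regular_at_weaken with (p + q); [lra|].
  split; auto; intros T HT.
  destruct (Wf T HT) as [M [HM WM]], (Wg T HT) as [N [HN WN]].
  exists (M * N * (2 / p + 2 / q)); split.
  - assert (0 < 2 / p + 2 / q) by (apply Rplus_lt_0_compat; apply Rdiv_lt_0_compat; lra).
    repeat apply Rmult_le_pos; lra.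
  - intros t Ht; apply norm_conv_le; auto; try lra.
    + intros x Hx; apply Cf; lra.
    + intros x Hx; apply Cg; lra.
    + intros x Hx; apply WM; lra.
    + intros x Hx; apply WN; lra.
Qed.

(** The cutoffs are removed one argument at a time, since convolution is continuous in one factor
    with the other fixed. *)
Lemma conv_assoc (f g u : R -> K) (t : R) :
  regular f -> regular g -> regular u -> 0 < t ->
  conv (conv f g) u t = conv f (conv g u) t.
Proof.
  assert (R0 : forall v, causal v -> regular v)
    by (intros v Hv; apply regular_of_continuous, Hv).
  assert (step1 : forall f g u, regular f -> causal g -> causal u ->
    forall t, 0 < t -> conv (conv f g) u t = conv f (conv g u) t).
  { clear f g u t; intros f g u Hf Hg Hu.
    destruct (cutoff_limit Hf) as [p [Hp HF]].
    assert (HFr : forall n, regular (cutoff n f)) by (intros; now apply regular_cutoff).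
    apply weighted_limit_unique with p p (fun n => conv (conv (cutoff n f) g) u).
    - apply weighted_limit_conv_l; auto using regular_conv.
      apply weighted_limit_conv_l; auto.
    - apply weighted_limit_ext with (F := fun n => conv (cutoff n f) (conv g u))
        (f := conv f (conv g u)); auto.
      + intros; symmetry; apply conv_assoc_causal; auto; now apply causal_cutoff.
      + apply weighted_limit_conv_l; auto using regular_conv. }
  assert (step2 : forall f g u, regular f -> regular g -> causal u ->
    forall t, 0 < t -> conv (conv f g) u t = conv f (conv g u) t).
  { clear f g u t; intros f g u Hf Hg Hu.
    destruct (cutoff_limit Hg) as [p [Hp HF]].
    assert (HFr : forall n, regular (cutoff n g)) by (intros; now apply regular_cutoff).
    apply weighted_limit_unique with p p (fun n => conv (conv f (cutoff n g)) u).
    - apply weighted_limit_conv_l; auto using regular_conv.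
      apply weighted_limit_conv_r; auto.
    - apply weighted_limit_ext with (F := fun n => conv f (conv (cutoff n g) u))
        (f := conv f (conv g u)); auto.
      + intros; symmetry; apply step1; auto; now apply causal_cutoff.
      + apply weighted_limit_conv_r; auto using regular_conv.
        apply weighted_limit_conv_l; auto. }
  intros Hf Hg Hu; revert t.
  destruct (cutoff_limit Hu) as [p [Hp HF]].
  assert (HFr : forall n, regular (cutoff n u)) by (intros; now apply regular_cutoff).
  apply weighted_limit_unique with p p (fun n => conv (conv f g) (cutoff n u)).
  - apply weighted_limit_conv_r; auto using regular_conv.
  - apply weighted_limit_ext with (F := fun n => conv f (conv g (cutoff n u)))
      (f := conv f (conv g u)); auto.
    + intros; symmetry; apply step2; auto; now apply causal_cutoff.
    + apply weighted_limit_conv_r; auto using regular_conv.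
      apply weighted_limit_conv_r; auto.
Qed.

End Associativity.

(** * Derivatives and primitives *)

(** The zero function f - f would have derivative l - l', and evaluating the remainder at x + d/2
    forces this to be small. Uniqueness is what gives [iota] its value in [deriv]. *)
Lemma is_derive_unique_R {V : NormedModule R_AbsRing} (f : R -> V) (x : R) (l l' : V) :
  is_derive f x l -> is_derive f x l' -> l = l'.
Proof.
  intros H H'; pose proof (is_derive_minus _ _ _ _ _ H H') as [_ D].
  specialize (D x (fun P HP => HP)).
  apply ball_norm_eq; intros eps.
  assert (He : 0 < eps / 2) by (pose proof (cond_pos eps); lra).
  destruct (D (mkposreal _ He)) as [d Hd]; pose proof (cond_pos d) as Hd0.
  assert (B : ball x d (x + d / 2)).
  { rewrite /ball /= /AbsRing_ball /= /abs /minus /plus /opp /=.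
    replace (x + d / 2 + - x) with (d / 2) by ring; rewrite Rabs_pos_eq; lra. }
  specialize (Hd _ B); simpl in Hd.
  rewrite !minus_eq_zero in Hd.
  assert (E : minus (x + d / 2) x = d / 2) by (rewrite /minus /plus /opp /=; ring).
  rewrite E {1}/minus plus_zero_l norm_opp in Hd.
  assert (N : norm (minus l l') <= Rabs (2 / d) * norm (scal (d / 2) (minus l l'))).
  { refine (Rle_trans _ _ _ _ (norm_scal (2 / d) (scal (d / 2) (minus l l')))).
    right; f_equal; rewrite scal_assoc -{1}(scal_one (minus l l')); f_equal.
    rewrite /mult /one /=; field; lra. }
  rewrite Rabs_pos_eq in N; [|left; apply Rdiv_lt_0_compat; lra].
  apply ball_norm_sym; apply Rle_lt_trans with (1 := N).
  apply Rle_lt_trans with (2 / d * (eps / 2 * (d / 2))).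
  - apply Rmult_le_compat_l; [left; apply Rdiv_lt_0_compat; lra|].
    apply Rle_trans with (1 := Hd); apply Rmult_le_compat_l; [lra|].
    right; apply (Rabs_pos_eq (d / 2)); lra.
  - replace (2 / d * (eps / 2 * (d / 2))) with (eps / 2) by (field; lra); lra.
Qed.

Section Derivatives.

Context {s : scalars}.
Notation K := (Sc s).

Lemma deriv_is (f : R -> K) (x : R) (l : K) : is_derive f x l -> deriv f x = l.
Proof.
  intros H; apply iota_unique; auto; intros y Hy; now apply is_derive_unique_R with f x.
Qed.

Lemma is_derive_deriv (f : R -> K) (x : R) : ex_derive f x -> is_derive f x (deriv f x).
Proof. intros [l H]; now rewrite (deriv_is H). Qed.

Lemma locally_pos (t : R) : 0 < t -> locally t (fun y => 0 < y).
Proof.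
  intros Ht; exists (mkposreal t Ht); intros y Hy.
  move: Hy; rewrite /ball /= /AbsRing_ball /= /abs /minus /plus /opp /=.
  move/Rabs_def2; lra.
Qed.

Lemma is_derive_ext_pos (f g : R -> K) (t : R) (l : K) :
  (forall x, 0 < x -> f x = g x) -> 0 < t -> is_derive f t l -> is_derive g t l.
Proof.
  intros E Ht; apply is_derive_ext_loc.
  generalize (locally_pos Ht); apply filter_imp; exact E.
Qed.

Lemma deriv_ext_pos (f g : R -> K) :
  (forall t, 0 < t -> f t = g t) -> forall t, 0 < t -> deriv f t = deriv g t.
Proof.
  intros E t Ht; apply: eq_close; apply (close_iota (T := Sc s)); intros l.
  split; apply is_derive_ext_pos; auto; intros; now rewrite E.
Qed.

Lemma deriv_n_ext n (f g : R -> K) :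
  (forall t, 0 < t -> f t = g t) -> forall t, 0 < t -> deriv_n n f t = deriv_n n g t.
Proof. intros E; induction n; [exact E | now apply deriv_ext_pos]. Qed.

Lemma differentiable_n_ext n (f g : R -> K) :
  (forall t, 0 < t -> f t = g t) -> differentiable_n n f -> differentiable_n n g.
Proof.
  intros E Hf j Hj t Ht; destruct (Hf j Hj t Ht) as [l Hl]; exists l.
  apply is_derive_ext_pos with (deriv_n j f); auto; now apply deriv_n_ext.
Qed.

Lemma deriv_n_S n (f : R -> K) : deriv_n (S n) f = deriv_n n (deriv f).
Proof. apply Nat.iter_succ_r. Qed.

Lemma differentiable_n_S n (f : R -> K) :
  differentiable_n (S n) f <->
  (forall t, 0 < t -> ex_derive f t) /\ differentiable_n n (deriv f).
Proof.
  split.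
  - intros H; split; [apply (H O); lia|].
    intros j Hj; rewrite -deriv_n_S; apply H; lia.
  - intros [H0 H] [|j] Hj; [exact H0|]; rewrite deriv_n_S; apply H; lia.
Qed.

Lemma differentiable_n_of_derive n (f g : R -> K) :
  (forall t, 0 < t -> is_derive f t (g t)) -> differentiable_n n g ->
  differentiable_n (S n) f /\ forall t, 0 < t -> deriv_n (S n) f t = deriv_n n g t.
Proof.
  intros Hf Hg.
  assert (E : forall t, 0 < t -> g t = deriv f t)
    by (intros; symmetry; now apply deriv_is, Hf).
  split.
  - apply differentiable_n_S; split; [intros t Ht; eexists; now apply Hf|].
    now apply differentiable_n_ext with g.
  - intros t Ht; rewrite deriv_n_S; symmetry; now apply deriv_n_ext.
Qed.

Lemma differentiable_n_plus n (f g : R -> K) :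
  differentiable_n n f -> differentiable_n n g ->
  differentiable_n n (fun t => plus (f t) (g t)) /\
  forall t, 0 < t ->
    deriv_n n (fun t => plus (f t) (g t)) t = plus (deriv_n n f t) (deriv_n n g t).
Proof.
  revert f g; induction n as [|n IH]; intros f g.
  { intros _ _; split; [intros j Hj; lia | reflexivity]. }
  intros [Df Hf]%differentiable_n_S [Dg Hg]%differentiable_n_S.
  destruct (IH _ _ Hf Hg) as [D E].
  destruct (@differentiable_n_of_derive n (fun t => plus (f t) (g t))
    (fun t => plus (deriv f t) (deriv g t))) as [D' E']; auto.
  - intros t Ht; apply: is_derive_plus; apply is_derive_deriv; auto.
  - split; auto; intros t Ht; rewrite E' // E // !deriv_n_S //.
Qed.

Lemma is_derive_linear (L : K -> K) (f : R -> K) (t : R) (l : K) :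
  is_linear L -> is_derive f t l -> is_derive (fun t => L (f t)) t (L l).
Proof.
  intros HL Hf.
  apply filterdiff_ext_lin with (fun y => L (scal y l)).
  - apply (filterdiff_comp f L _ L); auto; now apply filterdiff_linear.
  - intros y; now rewrite (linear_scal _ HL).
Qed.

Lemma differentiable_n_linear n (L : K -> K) (f : R -> K) :
  is_linear L -> differentiable_n n f ->
  differentiable_n n (fun t => L (f t)) /\
  forall t, 0 < t -> deriv_n n (fun t => L (f t)) t = L (deriv_n n f t).
Proof.
  intros HL; revert f; induction n as [|n IH]; intros f.
  { intros _; split; [intros j Hj; lia | reflexivity]. }
  intros [Df Hf]%differentiable_n_S.
  destruct (IH _ Hf) as [D E].
  destruct (@differentiable_n_of_derive n (fun t => L (f t)) (fun t => L (deriv f t)))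
    as [D' E']; auto.
  - intros t Ht; apply is_derive_linear; auto; apply is_derive_deriv; auto.
  - split; auto; intros t Ht; rewrite E' // E // !deriv_n_S //.
Qed.

Lemma differentiable_n_sum n m (F : nat -> R -> K) :
  (forall j, (j <= m)%nat -> differentiable_n n (F j)) ->
  differentiable_n n (fun t => sum_n (fun j => F j t) m) /\
  forall t, 0 < t ->
    deriv_n n (fun t => sum_n (fun j => F j t) m) t = sum_n (fun j => deriv_n n (F j) t) m.
Proof.
  induction m as [|m IH]; intros HF.
  - assert (E : forall t, 0 < t -> F O t = sum_n (fun j => F j t) 0)
      by (intros; now rewrite sum_O).
    split; [apply differentiable_n_ext with (F O); auto|].
    intros t Ht; rewrite sum_O; symmetry; now apply deriv_n_ext.
  - destruct IH as [D E]; [auto|].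
    destruct (differentiable_n_plus D (HF (S m) (le_n _))) as [D' E'].
    assert (ES : forall t, 0 < t ->
      plus (sum_n (fun j => F j t) m) (F (S m) t) = sum_n (fun j => F j t) (S m))
      by (intros; now rewrite sum_Sn).
    split; [now apply differentiable_n_ext with (2 := D')|].
    intros t Ht; rewrite sum_Sn -E // -E' //; symmetry; now apply deriv_n_ext.
Qed.

(** * Convolution with 1 as integration from 0 *)

Definition one_fun : R -> K := fun _ => sone s.

Lemma regular_one : regular one_fun.
Proof. apply regular_of_continuous; intros; apply continuous_const. Qed.

(** The derivative is O(t^(p-1)) with p > 0, hence integrable at 0, so f is Cauchy at 0+. The
    constant c is what separates f from its integral. *)
Lemma primitive_limit (f u : R -> K) :
  regular u -> (forall t, 0 < t -> is_derive f t (u t)) ->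
  exists c, filterlim f (at_right 0) (locally c) /\
    forall t, 0 < t -> conv one_fun u t = minus (f t) c.
Proof.
  intros Hu Hf.
  assert (Hc : exists c, filterlim f (at_right 0) (locally c)).
  { destruct (Hu) as [p [Hp [C W]]]; destruct (W 1 Rlt_0_1) as [M [HM WM]].
    apply (proj1 (filterlim_locally_cauchy (U := Sc s) (F := at_right 0) f)).
    intros eps.
    (* If x^p and y^p lie below this, then M/p |y^p - x^p| is at most eps M / (2 M + 1), which is
       less than eps. *)
    assert (He : 0 < eps * p / (2 * M + 1)).
    { pose proof (cond_pos eps); apply Rdiv_lt_0_compat; nra. }
    exists (fun x => 0 < x < Rmin 1 (Rpower (eps * p / (2 * M + 1)) (/ p))); split.
    { apply at_right_lt, Rmin_glb_lt; [lra | apply Rpower_gt_0]. }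
    assert (G : forall x, 0 < x < Rmin 1 (Rpower (eps * p / (2 * M + 1)) (/ p)) ->
      0 < x < 1 /\ 0 < Rpower x p < eps * p / (2 * M + 1)).
    { intros x Hx; pose proof (Rmin_l 1 (Rpower (eps * p / (2 * M + 1)) (/ p))).
      pose proof (Rmin_r 1 (Rpower (eps * p / (2 * M + 1)) (/ p))).
      split; [lra|]; split; [apply Rpower_gt_0 | apply Rpower_lt_radius; lra]. }
    intros x y [Hx1 Hx2]%G [Hy1 Hy2]%G.
    apply (norm_compat1 (V := Sc s)).
    assert (I : is_RInt u x y (minus (f y) (f x))).
    { assert (forall z, Rmin x y <= z -> 0 < z).
      { intros z Hz; apply Rlt_le_trans with (2 := Hz); apply Rmin_glb_lt; lra. }
      apply (is_RInt_derive f u); intros z [Hz _]; [apply Hf | apply C]; auto. }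
    assert (N : norm (minus (f y) (f x)) <= Rabs (M / p * Rpower y p - M / p * Rpower x p)).
    { apply (norm_RInt_antiderivative (f := u) (g := fun z => M * Rpower z (p - 1))
        (G := fun z => M / p * Rpower z p) (a := 0) (b := 1) (x := x) (y := y)); auto.
      - intros z Hz; apply WM; lra.
      - intros z Hz.
        replace (M * Rpower z (p - 1)) with (M / p * (p * Rpower z (p - 1))) by (field; lra).
        apply: is_derive_scal; apply is_derive_Rpower; lra.
      - intros z Hz; apply (continuous_scal_r (V := R_NormedModule)).
        apply continuous_Rpower; lra. }
    apply Rle_lt_trans with (1 := N).
    replace (M / p * Rpower y p - M / p * Rpower x p) with
      (M / p * (Rpower y p - Rpower x p)) by ring.
    assert (0 <= M / p) by (apply Rdiv_le_0_compat; lra).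
    rewrite Rabs_mult (Rabs_pos_eq (M / p)) //.
    apply Rle_lt_trans with (M / p * (eps * p / (2 * M + 1))).
    { apply Rmult_le_compat_l; auto; left; apply Rabs_def1; lra. }
    replace (M / p * (eps * p / (2 * M + 1))) with (eps * (M / (2 * M + 1)))
      by (field; lra).
    rewrite -{2}(Rmult_1_r eps); apply Rmult_lt_compat_l; [apply cond_pos|].
    apply Rmult_lt_reg_r with (2 * M + 1); [lra|].
    unfold Rdiv; rewrite Rmult_assoc Rinv_l; lra. }
  destruct Hc as [c Hc]; exists c; split; auto; intros t Ht.
  rewrite conv_comm //; [|apply regular_one].
  apply conv_unique.
  apply is_RInt_gen_ext with u.
  { apply filter_forall; intros xy x _; now rewrite smul_comm smul_one_l. }
  apply (is_RInt_gen_antiderivative (F := f)); auto.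
  - intros; apply Hf; lra.
  - intros; apply (regular_continuous Hu); lra.
  - refine (filterlim_filter_le_1 (F := locally t) _ _ _).
    { apply filter_le_within. }
    apply (ex_derive_continuous f); eexists; now apply Hf.
Qed.

(** The integral from 1 is proper and differentiable even if u is unbounded at 0; it differs from
    the convolution by a constant. *)
Lemma is_derive_conv_one (u : R -> K) (t : R) : regular u -> 0 < t ->
  is_derive (conv one_fun u) t (u t).
Proof.
  intros Hu Ht.
  assert (D : forall y, 0 < y -> is_derive (fun y => RInt u 1 y) y (u y)).
  { intros y Hy; apply is_derive_RInt with 1; [|now apply regular_continuous].
    generalize (locally_pos Hy); apply filter_imp; intros z Hz.
    apply (RInt_correct u), (ex_RInt_continuous u); intros x [Hx _].
    apply regular_continuous; auto; apply Rlt_le_trans with (2 := Hx); apply Rmin_glb_lt; lra. }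
  destruct (primitive_limit Hu D) as [c [_ E]].
  apply is_derive_ext_pos with (fun y => minus (RInt u 1 y) c); auto.
  { intros; now rewrite E. }
  rewrite -(minus_zero_r (u t)); apply: is_derive_minus; [now apply D|].
  apply: is_derive_const.
Qed.

Lemma conv_one_primitive (f u : R -> K) (t : R) :
  regular u -> (forall t, 0 < t -> is_derive f t (u t)) ->
  filterlim f (at_right 0) (locally (zero : K)) -> 0 < t -> conv one_fun u t = f t.
Proof.
  intros Hu Hf H0 Ht; destruct (primitive_limit Hu Hf) as [c [Hc E]].
  rewrite E //; replace c with (zero : K); [exact (minus_zero_r (f t))|].
  exact (filterlim_locally_unique (F := at_right 0) f _ _ H0 Hc).
Qed.

Lemma conv_one_inj (u v : R -> K) : regular u -> regular v ->
  (forall t, 0 < t -> conv one_fun u t = conv one_fun v t) ->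
  forall t, 0 < t -> u t = v t.
Proof.
  intros Hu Hv E t Ht; apply is_derive_unique_R with (conv one_fun u) t.
  - now apply is_derive_conv_one.
  - apply is_derive_ext_pos with (conv one_fun v); auto; [intros; now rewrite E|].
    now apply is_derive_conv_one.
Qed.

End Derivatives.

(** * The kernels h_j and Taylor's formula *)

Lemma exp_INR_mult n x : exp (INR n * x) = exp x ^ n.
Proof.
  induction n as [|n IH]; [rewrite Rmult_0_l exp_0; reflexivity|].
  rewrite S_INR Rmult_plus_distr_r Rmult_1_l exp_plus IH /=; ring.
Qed.

(** With c = j+1, e^t = (e^(t/c))^(j+1) >= (t/c)^(j+1), so t^j e^(-t) <= c^(j+1) / t. *)
Lemma filterlim_pow_exp_infty (j : nat) :
  filterlim (fun t => t ^ j * exp (- t)) (Rbar_locally p_infty) (locally 0).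
Proof.
  set c := INR (S j); assert (Hc : 0 < c) by (apply lt_0_INR; lia).
  apply filterlim_locally; intros eps.
  exists (Rmax 0 (c ^ S j / eps)); intros t Ht.
  pose proof (Rmax_l 0 (c ^ S j / eps)); pose proof (Rmax_r 0 (c ^ S j / eps)).
  rewrite /ball /= /AbsRing_ball /= /abs /minus /plus /opp /= Ropp_0 Rplus_0_r.
  assert (P : 0 < t ^ j) by (apply pow_lt; lra).
  assert (Q : 0 < c ^ S j) by now apply pow_lt.
  pose proof (exp_pos (- t)) as X; pose proof (cond_pos eps) as He.
  rewrite Rabs_pos_eq; [|left; now apply Rmult_lt_0_compat].
  assert (B : (t / c) ^ S j <= exp t).
  { replace (exp t) with (exp (t / c) ^ S j)
      by (rewrite -exp_INR_mult -/c; f_equal; field; lra).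
    apply pow_incr; split; [apply Rdiv_le_0_compat; lra|].
    pose proof (exp_ineq1_le (t / c)); lra. }
  assert (B' : t * t ^ j <= c ^ S j * exp t).
  { apply (Rmult_le_compat_l (c ^ S j)) in B; [|lra].
    rewrite -Rpow_mult_distr in B; replace (c * (t / c)) with t in B by (field; lra).
    exact B. }
  apply Rmult_lt_reg_l with t; [lra|].
  apply Rle_lt_trans with (c ^ S j).
  - rewrite -Rmult_assoc; apply (Rmult_le_compat_r (exp (- t))) in B'; [|lra].
    rewrite (Rmult_assoc (c ^ S j)) -exp_plus Rplus_opp_r exp_0 Rmult_1_r in B'; exact B'.
  - assert (c ^ S j / eps < t) by lra.
    apply Rmult_lt_reg_r with (/ eps); [now apply Rinv_0_lt_compat|].
    rewrite Rmult_assoc Rinv_r; lra.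
Qed.

(** Integration by parts gives this antiderivative of t^j e^(-t). It vanishes at +oo and equals -j!
    at 0, whence Gamma (j+1) = j!. *)
Fixpoint gamma_primitive (j : nat) (t : R) : R :=
  match j with
  | O => - exp (- t)
  | S i => - (t ^ S i * exp (- t)) + INR (S i) * gamma_primitive i t
  end.

Lemma is_derive_gamma_primitive j t :
  is_derive (gamma_primitive j) t (t ^ j * exp (- t)).
Proof.
  induction j as [|j IH]; cbn [gamma_primitive].
  - auto_derive; [trivial | simpl; ring].
  - replace (t ^ S j * exp (- t)) with
      (plus (opp (INR (S j) * t ^ j * exp (- t) - t ^ S j * exp (- t)))
         (INR (S j) * (t ^ j * exp (- t)))) by (rewrite /plus /opp /=; ring).
    apply: is_derive_plus; [apply: is_derive_opp | apply: is_derive_scal; exact IH].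
    auto_derive; [trivial|]; rewrite -/(INR (S j)) /pred; simpl pow; ring.
Qed.

Lemma gamma_primitive_0 j : gamma_primitive j 0 = - INR (fact j).
Proof.
  induction j as [|j IH]; cbn [gamma_primitive].
  - rewrite Ropp_0 exp_0 /=; reflexivity.
  - rewrite IH pow_i; [|lia]; rewrite fact_simpl mult_INR; ring.
Qed.

Lemma filterlim_gamma_primitive_infty j :
  filterlim (gamma_primitive j) (Rbar_locally p_infty) (locally 0).
Proof.
  induction j as [|j IH]; cbn [gamma_primitive].
  - apply filterlim_ext with (fun t => 0 * 0 - 1 * (t ^ 0 * exp (- t))).
    { intros t; simpl; ring. }
    replace (locally 0) with (locally (0 * 0 - 1 * 0)) by (f_equal; ring).
    apply (filterlim_linear_combination (u := fun _ => 0));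
      [apply filterlim_const | apply filterlim_pow_exp_infty].
  - apply filterlim_ext with
      (fun t => INR (S j) * gamma_primitive j t - 1 * (t ^ S j * exp (- t))).
    { intros t; ring. }
    replace (locally 0) with (locally (INR (S j) * 0 - 1 * 0)) by (f_equal; ring).
    apply filterlim_linear_combination; [exact IH | apply filterlim_pow_exp_infty].
Qed.

Lemma Gamma_INR (j : nat) : Gamma (INR (S j)) = INR (fact j).
Proof.
  unfold Gamma; refine (is_RInt_gen_unique (V := R_CompleteNormedModule) _ _ _).
  apply is_RInt_gen_filterlim with
    (fun xy => gamma_primitive j (snd xy) - gamma_primitive j (fst xy)).
  - apply (Filter_prod _ _ _ (fun x => 0 < x < 1) (fun y => 1 < y)).
    + apply at_right_lt; lra.
    + exists 1; auto.
    + intros x y Hx Hy; cbn [fst snd].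
      apply is_RInt_ext with (fun t => t ^ j * exp (- t)).
      { intros t; rewrite Rmin_left; [|lra]; intros Ht.
        rewrite S_INR; replace (INR j + 1 - 1) with (INR j) by ring.
        rewrite Rpower_pow; [|lra]; reflexivity. }
      apply (is_RInt_derive (gamma_primitive j)).
      * intros; apply is_derive_gamma_primitive.
      * intros; apply: ex_derive_continuous; auto_derive; trivial.
  - apply filterlim_ext with
      (fun xy => 1 * gamma_primitive j (snd xy) - 1 * gamma_primitive j (fst xy)).
    { intros; ring. }
    replace (INR (fact j)) with (1 * 0 - 1 * gamma_primitive j 0)
      by (rewrite gamma_primitive_0; ring).
    apply (filterlim_linear_combination (u := fun xy => gamma_primitive j (snd xy))
      (v := fun xy => gamma_primitive j (fst xy))).
    + eapply filterlim_comp; [apply filterlim_snd | apply filterlim_gamma_primitive_infty].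
    + eapply filterlim_comp; [apply filterlim_fst|].
      refine (filterlim_filter_le_1 (F := locally 0) _ _ _).
      { apply filter_le_within. }
      apply (ex_derive_continuous (gamma_primitive j)); eexists; apply is_derive_gamma_primitive.
Qed.

Section Taylor.

Context {s : scalars}.
Notation K := (Sc s).

(** The kernel h_{j+1} written with [pow]: [Rpower] is a power only for t > 0, whereas this form is
    continuous on all of R. *)
Definition monomial (j : nat) : R -> K :=
  fun t => scal (t ^ j / INR (fact j)) (sone s).

Lemma h_monomial (j : nat) (t : R) : 0 < t -> h (INR (S j)) t = monomial j t.
Proof.
  intros Ht; unfold h, monomial; rewrite Gamma_INR S_INR.
  replace (INR j + 1 - 1) with (INR j) by ring; now rewrite Rpower_pow.
Qed.

Lemma continuous_monomial j t : continuous (monomial j) t.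
Proof.
  apply (continuous_scal_l (fun t => t ^ j / INR (fact j)) (sone s)).
  apply: ex_derive_continuous; auto_derive; trivial.
Qed.

Lemma regular_h j : regular (h (s := s) (INR (S j))).
Proof.
  apply regular_ext with (monomial j); [intros; now rewrite h_monomial|].
  apply regular_of_continuous, continuous_monomial.
Qed.

Lemma h_1 (t : R) : 0 < t -> h (INR 1) t = one_fun (s := s) t.
Proof.
  intros Ht; rewrite h_monomial // /monomial /= /Rdiv Rinv_1 Rmult_1_l.
  exact (scal_one (sone s)).
Qed.

Lemma conv_one_h j (t : R) : 0 < t ->
  conv one_fun (h (s := s) (INR (S j))) t = h (INR (S (S j))) t.
Proof.
  intros Ht; rewrite (h_monomial (S j) Ht).
  apply (conv_one_primitive (f := monomial (S j))); auto; [apply regular_h| |].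
  - intros y Hy; rewrite h_monomial //.
    apply: is_derive_scal_l.
    assert (INR (fact j) <> 0) by apply INR_fact_neq_0.
    assert (0 < INR (S j)) by (apply lt_0_INR; lia).
    replace (y ^ j / INR (fact j)) with (INR (S j) * y ^ j / INR (fact (S j))).
    + auto_derive; [trivial|]; rewrite Rmult_1_l; reflexivity.
    + rewrite fact_simpl mult_INR; field; lra.
  - replace (zero : K) with (monomial (S j) 0).
    + refine (filterlim_filter_le_1 (F := locally 0) _ _ _).
      { apply filter_le_within. }
      apply continuous_monomial.
    + unfold monomial; rewrite pow_i; [|lia].
      rewrite /Rdiv Rmult_0_l; exact (scal_zero_l (sone s)).
Qed.

Lemma conv_h_S j (u : R -> K) (t : R) : regular u -> 0 < t ->
  conv (h (INR (S (S j)))) u t = conv one_fun (conv (h (INR (S j))) u) t.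
Proof.
  intros Hu Ht; rewrite -conv_assoc; auto using regular_one, regular_h.
  apply conv_ext_pos; auto; intros; now rewrite conv_one_h.
Qed.

Lemma conv_h_1 (u : R -> K) (t : R) : 0 < t -> conv (h (INR 1)) u t = conv one_fun u t.
Proof. intros Ht; apply conv_ext_pos; auto; apply h_1. Qed.

(** The kernel h_{j+1} is a product of j+1 copies of 1, and each differentiation removes one of
    them; the remaining i derivatives fall on u. *)
Lemma differentiable_n_conv_h j i (u : R -> K) : regular u -> differentiable_n i u ->
  differentiable_n (S j + i) (conv (h (INR (S j))) u) /\
  forall t, 0 < t -> deriv_n (S j + i) (conv (h (INR (S j))) u) t = deriv_n i u t.
Proof.
  intros Hu Hi; induction j as [|j [D E]].
  - apply differentiable_n_of_derive; auto; intros t Ht.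
    apply is_derive_ext_pos with (conv one_fun u); auto.
    + intros; now rewrite conv_h_1.
    + now apply is_derive_conv_one.
  - destruct (@differentiable_n_of_derive s (S j + i) (conv (h (INR (S (S j)))) u)
      (conv (h (INR (S j))) u)) as [D' E']; auto.
    + intros t Ht; apply is_derive_ext_pos with (conv one_fun (conv (h (INR (S j))) u)); auto.
      * intros; now rewrite conv_h_S.
      * apply is_derive_conv_one; auto using regular_conv, regular_h.
    + split; auto; intros t Ht; rewrite E' //; now apply E.
Qed.

Lemma regular_zero : regular (fun _ : R => (zero : K)).
Proof. apply regular_of_continuous; intros; apply continuous_const. Qed.

Lemma regular_smul (c : K) (f : R -> K) : regular f -> regular (fun t => smul s c (f t)).
Proof. apply (@regular_linear s (smul s c)), is_linear_smul. Qed.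

Lemma regular_sum m (F : nat -> R -> K) :
  (forall j, regular (F j)) -> regular (fun t => sum_n (fun j => F j t) m).
Proof.
  intros HF; induction m as [|m IH].
  - apply regular_ext with (F O); auto; intros; now rewrite sum_O.
  - apply regular_ext with (fun t => plus (sum_n (fun j => F j t) m) (F (S m) t)).
    + intros; now rewrite sum_Sn.
    + now apply regular_plus.
Qed.

Lemma conv_sum_l m (c : nat -> K) (F : nat -> R -> K) (u : R -> K) (t : R) :
  (forall j, regular (F j)) -> regular u -> 0 < t ->
  conv (fun x => sum_n (fun j => smul s (c j) (F j x)) m) u t =
  sum_n (fun j => smul s (c j) (conv (F j) u t)) m.
Proof.
  intros HF Hu Ht; induction m as [|m IH].
  - rewrite sum_O -conv_smul_l //; apply conv_ext_pos; auto; intros; now rewrite sum_O.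
  - rewrite sum_Sn -IH -conv_smul_l // -conv_plus_l //.
    + apply conv_ext_pos; auto; intros; now rewrite sum_Sn.
    + apply (@regular_sum m (fun j x => smul s (c j) (F j x))); intros; now apply regular_smul.
    + now apply regular_smul.
Qed.

Lemma regular_taylor n (f : R -> K) : regular (taylor n f).
Proof.
  apply (@regular_sum (pred n) (fun j t => smul s (deriv0 j f) (h (INR (S j)) t))).
  intros; apply regular_smul, regular_h.
Qed.

(** Induction on the order: the expansion of f' is integrated, and the constant of integration is
    the limit of f at 0+. *)
Lemma taylor_expansion m (f : R -> K) : C_m1_n (S m) f -> forall t, 0 < t ->
  f t = plus (taylor (S m) f t) (conv (h (INR (S m))) (deriv_n (S m) f) t).
Proof.
  revert f; induction m as [|m IH]; intros f [D C]; apply C_m1_regular in C.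
  - apply differentiable_n_S in D; destruct D as [D _].
    destruct (@primitive_limit s f (deriv f)) as [c [Hc E]]; auto.
    { intros; apply is_derive_deriv; auto. }
    assert (Ec : deriv0 0 f = c) by (apply (iota_filterlim_locally (F := at_right 0) f); auto).
    intros t Ht; rewrite conv_h_1 // /deriv_n /= E // /taylor /sum_upto /= sum_O Ec h_1 //.
    rewrite /one_fun smul_comm smul_one_l /minus plus_comm -plus_assoc plus_opp_l plus_zero_r //.
  - apply differentiable_n_S in D; destruct D as [D0 D].
    assert (Hf' : C_m1_n (S m) (deriv f)).
    { split; auto; rewrite -deriv_n_S; now apply regular_C_m1. }
    pose proof (IH _ Hf') as E'; rewrite -deriv_n_S in E'.
    set phi := deriv_n (S (S m)) f in C E' *.
    assert (Hr : regular (conv (h (INR (S m))) phi)) by auto using regular_conv, regular_h.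
    (* Only the top derivative is assumed to be in C_{-1}; for f' this follows from its own
       expansion, and it makes f(0) exist. *)
    assert (R' : regular (deriv f)).
    { eapply regular_ext; [intros t Ht; symmetry; now apply E'|].
      apply regular_plus; auto; apply regular_taylor. }
    destruct (@primitive_limit s f (deriv f)) as [c [Hc E]]; auto.
    { intros; apply is_derive_deriv; auto. }
    assert (Ec : deriv0 0 f = c) by (apply (iota_filterlim_locally (F := at_right 0) f); auto).
    intros t Ht.
    assert (Ef : f t = plus c (conv one_fun (deriv f) t)).
    { rewrite E // /minus plus_comm -plus_assoc plus_opp_l plus_zero_r //. }
    rewrite Ef (conv_ext_pos one_fun one_fun _ _ (fun _ _ => eq_refl) E' Ht).
    rewrite conv_plus_r; auto using regular_one, regular_taylor.
    rewrite -conv_h_S // plus_assoc; f_equal.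
    (* The term j = 0 is split off. The others come from the Taylor sum of f', as convolution with 1
       raises each index of h by one. *)
    rewrite /taylor /sum_upto /pred {2}/sum_n sum_Sn_m; [|lia].
    rewrite Ec h_1 // /one_fun (smul_comm c) smul_one_l; f_equal.
    rewrite -sum_n_m_S -/(sum_n _ m).
    rewrite conv_comm //; [|apply regular_one|apply (regular_taylor (S m) (deriv f))].
    rewrite conv_sum_l //; [|intros; apply regular_h|apply regular_one].
    apply sum_n_ext; intros j.
    rewrite conv_comm //; [|apply regular_h|apply regular_one].
    rewrite conv_one_h //; f_equal; rewrite /deriv0 deriv_n_S //.
Qed.

End Taylor.

(** * The Caputo derivative as a convolution *)

#[local] Hint Resolve regular_conv regular_one regular_h regular_taylor : core.

Section Caputo.

Context {s : scalars}.
Notation K := (Sc s).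

(** Only values on (0,+oo) matter, so this is the equality of the ring; as a setoid it permits
    rewriting inside convolutions. *)
Definition eqp (f g : R -> K) : Prop := forall t, 0 < t -> f t = g t.

Global Instance eqp_equivalence : Equivalence eqp.
Proof.
  split.
  - now intros f t Ht.
  - intros f g E t Ht; symmetry; now apply E.
  - intros f g u E E' t Ht; rewrite (E t Ht); now apply E'.
Qed.

Global Instance conv_eqp : Proper (eqp ==> eqp ==> eqp) conv.
Proof. intros f f' E g g' E' t Ht; now apply conv_ext_pos. Qed.

Global Instance regular_eqp : Proper (eqp ==> iff) regular.
Proof. intros f g E; split; apply regular_ext; auto; intros; now rewrite E. Qed.

Lemma convC (f g : R -> K) : regular f -> regular g -> eqp (conv f g) (conv g f).
Proof. intros Hf Hg t Ht; now apply conv_comm. Qed.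

Lemma convA (f g u : R -> K) : regular f -> regular g -> regular u ->
  eqp (conv (conv f g) u) (conv f (conv g u)).
Proof. intros Hf Hg Hu t Ht; now apply conv_assoc. Qed.

Lemma convCA (f g u : R -> K) : regular f -> regular g -> regular u ->
  eqp (conv f (conv g u)) (conv g (conv f u)).
Proof. intros; rewrite -convA // (convC (f := f)) // convA //. Qed.

Lemma convAC (f g u : R -> K) : regular f -> regular g -> regular u ->
  eqp (conv (conv f g) u) (conv (conv f u) g).
Proof. intros; rewrite convA // (convC (f := g)) // -convA //. Qed.

Lemma convACA (f g u v : R -> K) : regular f -> regular g -> regular u -> regular v ->
  eqp (conv (conv f g) (conv u v)) (conv (conv f u) (conv g v)).
Proof.
  intros; rewrite !convA; auto; rewrite (convCA (f := g)); auto; reflexivity.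
Qed.

Lemma conv_zero_l (f : R -> K) : regular f -> eqp (conv (fun _ => zero) f) (fun _ => zero).
Proof.
  intros Hf t Ht.
  transitivity (smul s zero (conv f f t)); [|apply smul_zero_l].
  rewrite -conv_smul_l //; apply conv_ext_pos; auto; intros; now rewrite smul_zero_l.
Qed.

Lemma regular_conv_pow n (f : R -> K) : regular f -> regular (conv_pow f n).
Proof.
  intros Hf; unfold conv_pow; induction (pred n) as [|m IH]; auto.
  now apply regular_conv.
Qed.

Lemma conv_pow_SS m (f : R -> K) : conv_pow f (S (S m)) = conv f (conv_pow f (S m)).
Proof. reflexivity. Qed.

Lemma conv_pow_eqp n (f g : R -> K) : eqp f g -> eqp (conv_pow f n) (conv_pow g n).
Proof.
  intros E; unfold conv_pow; induction (pred n) as [|m IH]; auto.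
  now apply conv_eqp.
Qed.

Lemma conv_pow_conv n (f g : R -> K) : regular f -> regular g ->
  eqp (conv_pow (conv f g) n) (conv (conv_pow f n) (conv_pow g n)).
Proof.
  (* Since [pred 0 = 0], [conv_pow f 0] is f itself, as for exponent 1. *)
  intros Hf Hg; destruct n as [|n]; [reflexivity|].
  induction n as [|n IH]; [reflexivity|].
  rewrite !conv_pow_SS IH convACA //; try reflexivity; now apply regular_conv_pow.
Qed.

Lemma conv_pow_one m : eqp (conv_pow one_fun (S m)) (h (INR (S m))).
Proof.
  induction m as [|m IH].
  - intros t Ht; symmetry; now apply h_1.
  - rewrite conv_pow_SS IH; intros t Ht; now apply conv_one_h.
Qed.

Lemma Caputo_primitive_eq (k f : R -> K) m : regular k -> C_m1_n (S m) f ->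
  eqp (Caputo_primitive k (S m) f)
      (conv (h (INR (S m))) (conv (conv_pow k (S m)) (deriv_n (S m) f))).
Proof.
  intros Hk Hf t Ht.
  assert (Hkn : regular (conv_pow k (S m))) by now apply regular_conv_pow.
  assert (Hphi : regular (deriv_n (S m) f)) by apply C_m1_regular, Hf.
  unfold Caputo_primitive.
  rewrite (conv_ext_pos _ _ _ _ (fun _ _ => eq_refl) (taylor_expansion Hf) Ht).
  rewrite conv_plus_r; auto using regular_conv, regular_taylor, regular_h.
  rewrite (conv_comm Hkn (regular_taylor (S m) f) Ht).
  rewrite (conv_sum_l (pred (S m)) (fun j => deriv0 j f) (fun j => h (INR (S j))));
    auto using regular_h.
  rewrite /minus (plus_comm (sum_n _ _)) -plus_assoc plus_opp_r plus_zero_r.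
  now apply convCA; auto using regular_h.
Qed.

Lemma Caputo_joint_eq (k f : R -> K) m : regular k -> C_m1_n (S m) f ->
  differentiable_n (S m) (Caputo_primitive k (S m) f) /\
  eqp (Caputo_derivative_joint k (S m) f) (conv (conv_pow k (S m)) (deriv_n (S m) f)).
Proof.
  intros Hk Hf.
  assert (Hg : regular (conv (conv_pow k (S m)) (deriv_n (S m) f))).
  { apply regular_conv; [now apply regular_conv_pow | apply C_m1_regular, Hf]. }
  pose proof (Caputo_primitive_eq Hk Hf) as E; symmetry in E.
  destruct (@differentiable_n_conv_h s m 0 _ Hg) as [D D'].
  { intros j Hj; lia. }
  rewrite Nat.add_0_r in D; rewrite Nat.add_0_r in D'.
  split; [now apply differentiable_n_ext with (2 := D)|].
  intros t Ht; etransitivity; [|exact (D' t Ht)]; symmetry; now apply deriv_n_ext.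
Qed.

(** The n-th derivative of h_{j+1} * k^n is that of k^n of order n-j-1, so each term of the sum in
    [Caputo_primitive] can be differentiated separately. *)
Lemma Caputo_separate (k f : R -> K) m : regular k -> C_m1_n (S m) f ->
  Caputo_terms_exist k (S m) f ->
  differentiable_n (S m) (conv (conv_pow k (S m)) f) /\
  eqp (Caputo_derivative k (S m) f) (Caputo_derivative_joint k (S m) f).
Proof.
  intros Hk Hf HT.
  set kn := conv_pow k (S m).
  assert (Hkn : regular kn) by now apply regular_conv_pow.
  destruct (Caputo_joint_eq Hk Hf) as [DP _].
  set F := fun j t => smul s (deriv0 j f) (conv (h (INR (S j))) kn t).
  assert (HF : forall j, (j <= m)%nat -> differentiable_n (S m) (F j) /\
    forall t, 0 < t ->
      deriv_n (S m) (F j) t = smul s (deriv0 j f) (deriv_n (S m - j - 1) kn t)).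
  (* With a zero coefficient the derivative of k^n may fail to exist, but the unspecified value of
     [deriv_n] is multiplied by zero. *)
  { intros j Hj; destruct (Req_EM_T (norm (deriv0 j f)) 0) as [Z|Z].
    - apply norm_eq_zero in Z.
      (* The zero function is presented as zero times a function known to be n times
         differentiable. *)
      destruct (@differentiable_n_conv_h s m 0 _ regular_one) as [D _].
      { intros i Hi; lia. }
      rewrite Nat.add_0_r in D.
      destruct (differentiable_n_linear (is_linear_smul zero) D) as [D' E'].
      assert (E : forall t, 0 < t -> smul s zero (conv (h (INR (S m))) one_fun t) = F j t)
        by (intros; unfold F; now rewrite Z !smul_zero_l).
      split; [now apply differentiable_n_ext with (2 := D')|].
      intros t Ht; rewrite -(deriv_n_ext (S m) _ _ E Ht) E' // Z !smul_zero_l //.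
    - assert (Hd : differentiable_n (S m - j - 1) kn).
      { apply HT; [lia|]; intros E; apply Z; rewrite E; apply: norm_zero. }
      destruct (@differentiable_n_conv_h s j _ kn Hkn Hd) as [D E].
      replace (S j + (S m - j - 1))%nat with (S m) in D, E by lia.
      destruct (differentiable_n_linear (is_linear_smul (deriv0 j f)) D) as [D' E'].
      split; [exact D'|]; intros t Ht; unfold F; rewrite E' // E //. }
  destruct (@differentiable_n_sum s (S m) m F) as [DS ES]; [apply HF|].
  destruct (differentiable_n_plus DP DS) as [D E].
  (* Adding the sum back to the joint primitive recovers k^n * f, which is thereby n times
     differentiable. *)
  assert (Ef : forall t, 0 < t ->
    plus (Caputo_primitive k (S m) f t) (sum_n (fun j => F j t) m) = conv kn f t).
  { intros t Ht; unfold Caputo_primitive, F, sum_upto, minus, pred.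
    rewrite -/kn -plus_assoc plus_opp_l plus_zero_r //. }
  split; [now apply differentiable_n_ext with (2 := D)|].
  intros t Ht; unfold Caputo_derivative, RL_derivative, sum_upto, pred.
  rewrite -/kn -(deriv_n_ext (S m) _ _ Ef Ht) E // ES //.
  rewrite (sum_n_ext_loc (fun j => deriv_n (S m) (F j) t)
    (fun j => smul s (deriv0 j f) (deriv_n (S m - j - 1) kn t)) m).
  - rewrite /minus -plus_assoc plus_opp_r plus_zero_r //.
  - intros j Hj; now apply HF.
Qed.

End Caputo.

(** * Convolution quotients *)

#[local] Hint Resolve regular_conv_pow : core.

Section QuotientField.

Context {s : scalars}.
Notation K := (Sc s).

(** The property is stable under convolution, so it passes from kappa to every denominator built
    from it. *)
Definition cancellable (d : R -> K) : Prop :=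
  forall u v, regular u -> regular v -> eqp (conv u d) (conv v d) -> eqp u v.

(* [kappa] is cancelled by convolving with [k] and differentiating, so that the absence of
   zero divisors (Titchmarsh's theorem) is not needed. *)
Lemma cancellable_Sonine (kappa k : R -> K) : regular kappa -> regular k ->
  eqp (conv kappa k) one_fun -> cancellable kappa.
Proof.
  intros Hkappa Hk E u v Hu Hv Euv t Ht; apply conv_one_inj; auto.
  change (eqp (conv one_fun u) (conv one_fun v)).
  rewrite -E !(convC (f := conv kappa k)); auto; rewrite -!convA; auto.
  rewrite Euv; reflexivity.
Qed.

Lemma cancellable_conv (a b : R -> K) : regular a -> regular b ->
  cancellable a -> cancellable b -> cancellable (conv a b).
Proof.
  intros Ha Hb Ca Cb u v Hu Hv; rewrite -!convA; auto.
Qed.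

Lemma cancellable_conv_pow (a : R -> K) n :
  regular a -> cancellable a -> cancellable (conv_pow a n).
Proof.
  intros Ha Ca; destruct n as [|n]; auto; induction n as [|n IH]; auto.
  rewrite conv_pow_SS; apply cancellable_conv; auto.
Qed.

(** If d were zero, 1 and 0 would have the same product with d, and cancelling d would give 1 =
    0. *)
Lemma cancellable_nonzero (d : R -> K) : regular d -> cancellable d ->
  ~ (forall t, 0 < t -> d t = zero).
Proof.
  intros Hd Cd Z; apply (sone_neq_zero (s := s)).
  refine (Cd one_fun (fun _ => zero) _ _ _ 1 Rlt_0_1); auto; [apply regular_zero|].
  change (eqp d (fun _ => zero)) in Z.
  rewrite conv_zero_l // Z convC //; [now rewrite conv_zero_l | apply regular_zero].
Qed.

(** * Equality of quotients with cancellable denominators *)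

Definition cancellable_fraction (p : fraction s) : Prop :=
  regular (num p) /\ regular (den p) /\ cancellable (den p).

Lemma proper_cancellable_fraction (p : fraction s) :
  cancellable_fraction p -> proper_fraction p.
Proof.
  intros [Hn [Hd Cd]]; split; [|split]; try now apply regular_C_m1.
  now apply cancellable_nonzero.
Qed.

(** Transitivity through p cancels only the middle denominator [den p]. That matters because r is
    any proper fraction, about whose denominator no cancellation law is known. *)
Lemma class_of_equiv (p q : fraction s) : cancellable_fraction p -> cancellable_fraction q ->
  equiv_fraction p q -> forall r, class_of p r -> class_of q r.
Proof.
  intros [Np [Dp Cp]] [Nq [Dq _]] Epq r [[Nr [Dr Zr]] Epr].
  split; [now split|].
  apply C_m1_regular in Nr; apply C_m1_regular in Dr.
  change (eqp (conv (num p) (den q)) (conv (num q) (den p))) in Epq.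
  change (eqp (conv (num p) (den r)) (conv (num r) (den p))) in Epr.
  apply Cp; auto.
  rewrite (convAC (f := num q)); auto; rewrite -Epq (convAC (f := num p)); auto.
  rewrite Epr; rewrite convAC; auto; reflexivity.
Qed.

Lemma eq_quotient_cancellable (p q : fraction s) :
  cancellable_fraction p -> cancellable_fraction q -> equiv_fraction p q -> eq_quotient p q.
Proof.
  intros Hp Hq E; split; [|split]; try now apply proper_cancellable_fraction.
  apply functional_extensionality; intros r; apply propositional_extensionality; split.
  - now apply class_of_equiv.
  - apply class_of_equiv; auto; intros t Ht; symmetry; now apply E.
Qed.

Lemma num_qpow (p : fraction s) n : num (qpow p n) = conv_pow (num p) n.
Proof.
  unfold qpow, conv_pow; induction (pred n) as [|m IH]; auto; simpl; now rewrite IH.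
Qed.

Lemma den_qpow (p : fraction s) n : den (qpow p n) = conv_pow (den p) n.
Proof.
  unfold qpow, conv_pow; induction (pred n) as [|m IH]; auto; simpl; now rewrite IH.
Qed.

(* In the notation of the theorem: [a = kappa^n], [b = k^n], [u = f - f_n] and
   [phi] is the [n]-th derivative of [f]. *)
Lemma Caputo_cross_identity (a b phi kappa d g u : R -> K) :
  regular a -> regular b -> regular phi -> regular kappa ->
  eqp d (conv a a) -> eqp g (conv b phi) -> eqp u (conv (conv a b) phi) ->
  eqp (conv (conv g kappa) (conv d kappa)) (conv (conv a (conv u kappa)) kappa).
Proof.
  intros Ha Hb Hphi Hkappa Ed Eg Eu.
  assert (Rg : regular g) by (rewrite Eg; auto).
  assert (Ru : regular u) by (rewrite Eu; auto).
  assert (Rd : regular d) by (rewrite Ed; auto).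
  assert (E : eqp (conv g d) (conv a u)).
  { rewrite Eg Ed Eu (convC (f := conv b phi)); auto.
    rewrite (convA (f := a) (g := b)) // -(convA (f := a) (g := a)); auto; reflexivity. }
  rewrite convACA // E !convA; auto; reflexivity.
Qed.

(** Stated for any g equal to k^n * f^(n) on (0,+oo), so that it serves both forms of the Caputo
    derivative. *)
Lemma coincides_of_eqp (kappa k f g : R -> K) m :
  Sonine_pair kappa k -> C_m1_n (S m) f ->
  eqp g (conv (conv_pow k (S m)) (deriv_n (S m) f)) ->
  coincides_with_algebraic kappa (S m) f g.
Proof.
  intros [Hkappa [Hk Esonine]] Hf Eg.
  assert (Rkappa : regular kappa).
  { apply C_m1_regular; destruct Hkappa as [p [Hp H]]; exists p; split; auto; lra. }
  assert (Rk : regular k).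
  { apply C_m1_regular; destruct Hk as [p [Hp H]]; exists p; split; auto; lra. }
  pose proof (cancellable_Sonine Rkappa Rk Esonine) as Ckappa.
  set phi := deriv_n (S m) f in Eg *.
  assert (Rphi : regular phi) by apply C_m1_regular, Hf.
  (* A is the numerator of S_kappa^n, and D, introduced next, is its denominator. *)
  set A := conv_pow kappa (S m); set B := conv_pow k (S m) in Eg *.
  set D := conv_pow (conv kappa kappa) (S m); set H := h (s := s) (INR (S m)).
  assert (RA : regular A) by now apply regular_conv_pow.
  assert (RB : regular B) by now apply regular_conv_pow.
  assert (RD : regular D) by now apply regular_conv_pow, regular_conv.
  assert (RH : regular H) by apply regular_h.
  assert (Rg : regular g) by (rewrite Eg; auto).
  assert (ED : eqp D (conv A A)) by now apply conv_pow_conv.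
  assert (EH : eqp (conv A B) H).
  { unfold A, B; rewrite -conv_pow_conv //.
    rewrite (conv_pow_eqp (S m) (f := conv kappa k) (g := one_fun)) //.
    apply conv_pow_one. }
  set w := fun t => minus (f t) (taylor (S m) f t).
  assert (Ew : eqp w (conv H phi)).
  { intros t Ht; unfold w; rewrite (taylor_expansion Hf Ht) /minus.
    rewrite (plus_comm (taylor _ _ _)) -plus_assoc plus_opp_r plus_zero_r //. }
  assert (Rf : regular f).
  { eapply regular_ext; [intros t Ht; symmetry; now apply (taylor_expansion Hf)|].
    apply regular_plus; auto. }
  assert (Rw : regular w) by (rewrite Ew; auto).
  assert (CD : cancellable D).
  { apply cancellable_conv_pow; auto; now apply cancellable_conv. }
  (* E is the denominator of both S_kappa^n f and S_kappa^n f_n, and X u below is the numerator of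
     S_kappa^n u. By linearity their difference is (X w * E) / (E * E). *)
  set E := conv D kappa; assert (RE : regular E) by (unfold E; auto).
  assert (CE : cancellable E) by now apply cancellable_conv.
  set X := fun u => conv A (conv u kappa).
  assert (RX : forall u, regular u -> regular (X u)) by (unfold X; auto).
  assert (Enum : eqp (num (algebraic_Caputo kappa (S m) f)) (conv (X w) E)).
  { intros t Ht; unfold algebraic_Caputo, qsub, qadd, qopp, qmul, embed; cbn [num den].
    rewrite !num_qpow !den_qpow.
    change (plus (conv (X f) E t) (conv (fun t => opp (X (taylor (S m) f) t)) E t) =
      conv (X w) E t).
    rewrite -conv_plus_l //; [|now apply RX|apply regular_opp; now apply RX].
    apply conv_ext_pos; auto; intros y Hy; unfold X.
    symmetry; transitivity
      (conv A (fun x => minus (conv f kappa x) (conv (taylor (S m) f) kappa x)) y).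
    { apply conv_ext_pos; auto; intros x Hx; now apply conv_minus_l. }
    rewrite conv_minus_r //; auto. }
  assert (Eden : den (algebraic_Caputo kappa (S m) f) = conv E E).
  { unfold algebraic_Caputo, qsub, qadd, qopp, qmul, embed; cbn [num den].
    now rewrite !den_qpow. }
  assert (EX : eqp (conv (conv g kappa) E) (conv (X w) kappa)).
  { apply (@Caputo_cross_identity A B phi kappa D g w); auto; rewrite EH; exact Ew. }
  clearbody w E X.
  split; [now apply regular_C_m1|]; apply eq_quotient_cancellable.
  - unfold embed, cancellable_fraction; cbn [num den]; auto.
  - unfold cancellable_fraction; rewrite Eden Enum; split; [|split]; auto.
    now apply cancellable_conv.
  - unfold equiv_fraction; rewrite Eden.
    change (eqp (conv (conv g kappa) (conv E E)) (conv (num (algebraic_Caputo kappa (S m) f)) kappa)).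
    (* One copy of E is absorbed by [EX]; the other is the common factor left by subtracting
       fractions with equal denominators. *)
    rewrite Enum -(convA (g := E)) // ?EX; auto; rewrite convAC; auto; reflexivity.
Qed.

End QuotientField.

Theorem theorem4p3 (s : scalars) (kappa k : R -> Sc s)
  (hk : Sonine_pair kappa k)
  (n : nat) (hn : (1 <= n)%nat)
  (f : R -> Sc s) (hf : C_m1_n n f) :
  (Caputo_terms_exist k n f ->
     differentiable_n n (conv (conv_pow k n) f) /\
     (forall t : R, (0 < t)%R ->
        Caputo_derivative k n f t = Caputo_derivative_joint k n f t) /\
     coincides_with_algebraic kappa n f (Caputo_derivative k n f)) /\
  differentiable_n n (Caputo_primitive k n f) /\
  coincides_with_algebraic kappa n f (Caputo_derivative_joint k n f).
Proof.
  destruct n as [|m]; [lia|].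
  assert (Rk : regular k).
  { apply C_m1_regular; destruct hk as [_ [[p [Hp H]] _]]; exists p; split; auto; lra. }
  destruct (Caputo_joint_eq Rk hf) as [D E]; split; [|split; auto].
  - intros HT; destruct (Caputo_separate Rk hf HT) as [D' E']; split; [|split]; auto.
    apply coincides_of_eqp with k; auto; now rewrite E'.
  - now apply coincides_of_eqp with k.
Qed.
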